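(* Let $W=\{w(s)\mid s\in\Sigma\}$ be a tight continuous frame (with constant $1$) in the Hilbert space $\mathcal H$, contained and total in a Fréchet space $\mathcal G$ continuously and densely embedded in $\mathcal H$, such that $s\mapsto\langle u,w(s)\rangle$ is continuous for every $u\in\mathcal G'$. Let $\mathcal M$ be a solid Banach space of functions on $\Sigma$ with absolutely continuous norm, and assume that the completed coorbit space $\widetilde{\mathsf{co}}(\mathcal M)$ is continuously embedded in $\mathcal G'_\sigma$. Let $\mathcal X$ be a Banach space and $\mathscr K$ a subset of $\mathbb B[\mathcal X,\widetilde{\mathsf{co}}(\mathcal M)]$. Then $\mathscr K$ is a relatively compact family (in the operator norm topology) of compact operators if and only if both of the following conditions hold: 1. For every $\epsilon>0$ there exists a compact set $L\subset\Sigma$ such that $\sup_{S\in\mathscr K}\|\chi_{L^c}\circ\phi_W\circ S\|_{\mathbb B(\mathcal X,\mathcal M)}\le\epsilon$. 2. There is a sequence $(x_n')_n$ in $\mathcal X'$ with $x'_n\to0$ in norm such that $\sup_{S\in\mathscr K}\|\phi_W(Sx)\|_{\mathcal M}\le\sup_n|\langle x_n',x\rangle|$ for every $x\in\mathcal X$. If $\mathcal X$ does not contain an isomorphic copy of $\ell^1$, then condition 2 can be replaced by: 2'. If $x_n\to0$ weakly in $\mathcal X$, then $\sup_{S\in\mathscr K}\|\phi_W(Sx_n)\|_{\mathcal M}\to0$.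
   Context: $\mathcal H$ is a complex separable Hilbert space; $\Sigma$ is a Hausdorff, locally compact, $\sigma$-compact space with a fixed Radon measure $\mu$. $\mathbb B(\mathcal X,\mathcal Y)$ denotes the bounded linear operators from $\mathcal X$ to $\mathcal Y$ and $\mathcal X'$ the topological dual of $\mathcal X$. Tight continuous frame (constant $1$): $W=\{w(s)\mid s\in\Sigma\}\subset\mathcal H$, the map $s\mapsto w(s)$ is weakly continuous, and $\langle u,v\rangle=\int_\Sigma\langle u,w(s)\rangle\langle w(s),v\rangle\,d\mu(s)$ for all $u,v\in\mathcal H$. $\mathcal G'$ is the topological dual of $\mathcal G$, where by the Riesz isomorphism one has a Gelfand triple $\mathcal G\subset\mathcal H\subset\mathcal G'$; $\langle u,v\rangle$, for $u\in\mathcal G'$, $v\in\mathcal G$, denotes the value of $u$ on $v$ and extends the inner product of $\mathcal H$ (so $\mathcal G'$ is realized as the continuous antilinear functionals on $\mathcal G$). $\mathcal G'_\sigma$ is $\mathcal G'$ with the weak-$*$ topology. ''Total'' means having dense linear span. For $u\in\mathcal G'$, $\phi_W(u)$ is the continuous function $[\phi_W(u)](s):=\langle u,w(s)\rangle$ on $\Sigma$. The coorbit space is $\mathsf{co}(\mathcal M):=\{u\in\mathcal G'\mid\phi_W(u)\in\mathcal M\}$ with norm $\|u\|_{\mathsf{co}(\mathcal M)}:=\|\phi_W(u)\|_{\mathcal M}$; $\widetilde{\mathsf{co}}(\mathcal M)$ is its completion, and the canonical isometric extension $\widetilde{\mathsf{co}}(\mathcal M)\to\mathcal M$ of $\phi_W$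 is denoted by the same symbol. The assumption that $\widetilde{\mathsf{co}}(\mathcal M)$ is continuously embedded in $\mathcal G'_\sigma$ means that the inclusion $\mathsf{co}(\mathcal M)\to\mathcal G'_\sigma$ extends to a continuous injective linear map on $\widetilde{\mathsf{co}}(\mathcal M)$. Solid Banach space of functions with absolutely continuous norm: a Banach space $\mathcal M$ of ($\mu$-a.e. classes of) $\mu$-measurable functions $\Sigma\to\mathbb C$ such that: (i) $\mathcal M$ contains the characteristic functions of all measurable $M\subset\Sigma$ with $\mu(M)<\infty$; (ii) if $f,g:\Sigma\to\mathbb C$ are $\mu$-measurable, $|f|\le|g|$ a.e. and $g\in\mathcal M$, then $f\in\mathcal M$ and $\|f\|_{\mathcal M}\le\|g\|_{\mathcal M}$; (iii) (dominated convergence) for $f,g\in\mathcal M$, if $f_n:\Sigma\to\mathbb C$ are measurable, $|f_n|\le|g|$ and $f_n\to f$ $\mu$-a.e., then $\|f_n-f\|_{\mathcal M}\to0$. For compact $L\subset\Sigma$, $\chi_{L^c}$ is the characteristic function of the complement of $L$, acting on $\mathcal M$ by multiplication. *)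

(* Defs.v *)
From HB Require Import structures.
From mathcomp Require Import all_boot all_order all_algebra.
From mathcomp Require Import all_classical all_reals all_analysis.
From mathcomp Require Import complex.

Set Implicit Arguments.
Unset Strict Implicit.
Unset Printing Implicit Defensive.

Import Order.TTheory GRing.Theory Num.Theory.
Import numFieldNormedType.Exports.

Local Open Scope classical_set_scope.
Local Open Scope ring_scope.
Local Open Scope complex_scope.

Section norms.
Context {R : realType}.

(* The norm of a normed R[i]-module is R[i]-valued; this is the same number in
   R. *)
Definition rnorm (V : normedModType R[i]) (x : V) : R := complex.Re `|x|.

(* 0 is added so that the supremum over an empty index set is 0, not -oo. *)
Definition esup0 (I : Type) (A : set I) (F : I -> \bar R) : \bar R :=
  ereal_sup (0%E |` [set F i | i in A]).

Definition unit_ball (V : normedModType R[i]) : set V := [set x | `|x| <= 1].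

(* Defined for arbitrary maps, with value +oo if f is unbounded on the unit
   ball. *)
Definition opnorm (X Y : normedModType R[i]) (f : X -> Y) : \bar R :=
  esup0 (@unit_ball X) (fun x => (rnorm (f x))%:E).

Lemma normE (V : normedModType R[i]) (x : V) : `|x| = (rnorm x)%:C.
Proof. by rewrite /rnorm RRe_real// ger0_real. Qed.

Lemma esup0_ub (I : Type) (A : set I) (F : I -> \bar R) i :
  A i -> (F i <= esup0 A F)%E.
Proof. by move=> Ai; apply: ereal_sup_ubound; right; exists i. Qed.

Lemma esup0_ge0 (I : Type) (A : set I) (F : I -> \bar R) : (0 <= esup0 A F)%E.
Proof. by apply: ereal_sup_ubound; left. Qed.

Lemma esup0_le (I : Type) (A : set I) (F : I -> \bar R) (M : \bar R) :
  (0 <= M)%E -> (forall i, A i -> (F i <= M)%E) -> (esup0 A F <= M)%E.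
Proof. by move=> M0 FM; apply: ge_ereal_sup => _ [->//|[i Ai <-]]; exact: FM. Qed.

End norms.

Section bounded_operators.
Context {R : realType} (X Y : normedModType R[i]).

(* The space of bounded linear operators; the norm instance at the end of this
   section makes its topology the operator norm topology. *)
Definition bop_pred : {pred X -> Y} :=
  [pred f : X -> Y | `[< linear f /\ continuous f >]].

Lemma bop_predP (f : X -> Y) :
  reflect (linear f /\ continuous f) (f \in bop_pred).
Proof. exact: asboolP. Qed.

Record bop := Bop { bop_fun :> X -> Y ; _ : bop_fun \in bop_pred }.

HB.instance Definition _ := [isSub for bop_fun].
HB.instance Definition _ := [Choice of bop by <:].

Lemma bop_submod_closed : submod_closed bop_pred.
Proof.
split=> [|a f g].
  apply/bop_predP; split=> [a u v|x]; last exact: cvg_cst.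
  by rewrite -[LHS]/(0 : Y) -[RHS]/(a *: (0 : Y) + (0 : Y)) scaler0 addr0.
move=> /bop_predP[lf cf] /bop_predP[lg cg]; apply/bop_predP; split.
  move=> b u v; rewrite !fctE lf lg !scalerDr !scalerA [b * a]mulrC.
  by rewrite -!addrA; congr +%R; rewrite addrCA.
move=> x; apply: cvgD; last exact: cg.
by apply: cvgZ; [exact: cvg_cst|exact: cf].
Qed.

HB.instance Definition _ :=
  GRing.isSubmodClosed.Build _ _ bop_pred bop_submod_closed.
HB.instance Definition _ := [SubChoice_isSubLmodule of bop by <:].

Lemma bop_linear (f : bop) : linear f.
Proof. by case: f => f /=; move=> /bop_predP[]. Qed.

HB.instance Definition _ (f : bop) :=
  GRing.isLinear.Build _ _ _ _ (bop_fun f) (bop_linear f).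

Lemma bop_continuous (f : bop) : continuous f.
Proof. by case: f => f /=; move=> /bop_predP[]. Qed.

Lemma opnorm_bop_fin (f : bop) : opnorm f \is a fin_num.
Proof.
have /linear_bounded_continuous/linear_boundedP/pinfty_ex_gt0[r r0 fr] :=
  @bop_continuous f.
rewrite ge0_fin_numE; last exact: esup0_ge0.
apply: (@le_lt_trans _ _ (complex.Re r)%:E); last exact: ltry.
have rE : r = (complex.Re r)%:C by rewrite RRe_real// gtr0_real.
apply: esup0_le => [|x x1]; first by rewrite lee_fin -(@lecR R) -rE ltW.
rewrite lee_fin -(@lecR R) -normE -rE (le_trans (fr x))//.
by rewrite ger_pMr.
Qed.

Definition bop_norm (f : bop) : R[i] := (fine (opnorm f))%:C.

Lemma bop_normP (f : bop) (x : X) : `|f x| <= bop_norm f * `|x|.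
Proof.
have [->|x0] := eqVneq x 0; first by rewrite linear0 !normr0 mulr0.
have nx0 : 0 < `|x| by rewrite normr_gt0.
pose y := `|x|^-1 *: x.
have y1 : `|y| = 1.
  by rewrite normrZ ger0_norm ?invr_ge0// mulVf// gt_eqF.
have xE : x = `|x| *: y by rewrite scalerA mulfV ?scale1r// gt_eqF.
rewrite {1}xE linearZ/= normrZ normr_id mulrC ler_wpM2r//.
rewrite (normE (f y)) /bop_norm lecR -lee_fin fineK ?opnorm_bop_fin//.
by apply: (@esup0_ub _ _ _ (fun x => (rnorm (f x))%:E)); rewrite /unit_ball/= y1.
Qed.

Lemma bop_norm_ge0 (f : bop) : 0 <= bop_norm f.
Proof. by rewrite /bop_norm -[0]/(0%:C) lecR fine_ge0// esup0_ge0. Qed.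

Lemma bop_norm_le (f : bop) (M : R[i]) : 0 <= M ->
  (forall x, `|x| <= 1 -> `|f x| <= M) -> bop_norm f <= M.
Proof.
move=> M0 fM; have ME : M = (complex.Re M)%:C by rewrite RRe_real// ger0_real.
rewrite ME /bop_norm lecR -lee_fin fineK ?opnorm_bop_fin//.
apply: esup0_le => [|x x1]; first by rewrite lee_fin -(@lecR R) -ME.
by rewrite lee_fin -(@lecR R) -normE -ME fM.
Qed.

Lemma bop_ler_normD (f g : bop) : bop_norm (f + g) <= bop_norm f + bop_norm g.
Proof.
apply: bop_norm_le => [|x x1]; first by rewrite addr_ge0 ?bop_norm_ge0.
rewrite (le_trans (ler_normD _ _))// lerD// (le_trans (bop_normP _ _))//.
  by rewrite ler_piMr// bop_norm_ge0.
by rewrite ler_piMr// bop_norm_ge0.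
Qed.

Lemma bop_normZ_le (a : R[i]) (f : bop) :
  bop_norm (a *: f) <= `|a| * bop_norm f.
Proof.
apply: bop_norm_le => [|x x1]; first by rewrite mulr_ge0 ?bop_norm_ge0.
rewrite [X in `|X|](_ : _ = a *: f x)// normrZ ler_wpM2l//.
by rewrite (le_trans (bop_normP _ _))// ler_piMr// bop_norm_ge0.
Qed.

Lemma bop_normrZ (a : R[i]) (f : bop) : bop_norm (a *: f) = `|a| * bop_norm f.
Proof.
apply/eqP; rewrite eq_le bop_normZ_le/=.
have [->|a0] := eqVneq a 0; first by rewrite normr0 mul0r bop_norm_ge0.
rewrite mulrC -ler_pdivlMr ?normr_gt0// mulrC.
rewrite -[X in bop_norm X <= _]scale1r -(mulVf a0) -scalerA.
by rewrite (le_trans (bop_normZ_le _ _))// normfV.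
Qed.

Lemma bop_normr0_eq0 (f : bop) : bop_norm f = 0 -> f = 0.
Proof.
move=> f0; apply/val_inj/funext => x /=; apply/eqP; rewrite -normr_le0.
by rewrite (le_trans (bop_normP _ _))// f0 mul0r.
Qed.

HB.instance Definition _ := Lmodule_isNormed.Build R[i] bop
  bop_ler_normD bop_normrZ bop_normr0_eq0.

End bounded_operators.

Section antidual.
Context {R : realType} (G : tvsType R[i]).

(* The dual of G is realized by continuous antilinear functionals, so that h in
   a Hilbert space H containing G acts on G by g |-> <h, g>, for an inner
   product that is linear in its first argument. *)
Definition antidual_pred : {pred G -> R[i]^o} :=
  [pred u : G -> R[i]^o |
    `[< (forall a x y, u (a *: x + y) = (a^*)%R * u x + u y) /\ continuous u >]].

Lemma antidual_predP (u : G -> R[i]^o) :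
  reflect ((forall a x y, u (a *: x + y) = (a^*)%R * u x + u y) /\ continuous u)
    (u \in antidual_pred).
Proof. exact: asboolP. Qed.

Record antidual :=
  Antidual { antidual_fun :> G -> R[i]^o ; _ : antidual_fun \in antidual_pred }.

HB.instance Definition _ := [isSub for antidual_fun].
HB.instance Definition _ := [Choice of antidual by <:].

Lemma antidual_submod_closed : submod_closed antidual_pred.
Proof.
split=> [|b u v].
  apply/antidual_predP; split=> [a x y|x]; last exact: cvg_cst.
  by rewrite -[LHS]/(0 : R[i]) -[RHS]/((a^*)%R * 0 + 0 : R[i]) mulr0 addr0.
move=> /antidual_predP[lu cu] /antidual_predP[lv cv].
apply/antidual_predP; split.
  move=> a x y; rewrite !fctE lu lv !scalerDr mulrDr -!addrA.
  congr +%R; first by rewrite -[LHS]/(b * _) -[in RHS]/(b * _) mulrCA.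
  by rewrite addrCA.
move=> x; apply: cvgD; last exact: cv.
by apply: cvgZ; [exact: cvg_cst|exact: cu].
Qed.

HB.instance Definition _ :=
  GRing.isSubmodClosed.Build _ _ antidual_pred antidual_submod_closed.
HB.instance Definition _ := [SubChoice_isSubLmodule of antidual by <:].

(* Weak-* topology, that is, pointwise convergence on G. *)
Definition antidual_eval (u : antidual) : {ptws G -> R[i]^o} := antidual_fun u.

HB.instance Definition _ :=
  Topological.copy antidual (initial_topology antidual_eval).

End antidual.

Notation borel S := (g_sigma_algebraType (@open S)).

Section function_spaces.
Context {R : realType} {S : ptopologicalType}.
Variable mu : {measure set (borel S) -> \bar R}.
Local Notation C := (R[i]^o).

(* On a sigma-compact locally compact Hausdorff space, this agrees with the
   variant requiring inner regularity on all Borel sets. *)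
Record radon_measure : Prop := RadonMeasure {
  radon_compact : forall K : set S, compact K -> (mu K < +oo)%E ;
  radon_outer : forall A : set (borel S), measurable A ->
    mu A = ereal_inf [set mu U | U in [set U : set S | open U /\ A `<=` U]] ;
  radon_inner : forall U : set S, open U ->
    mu U = ereal_sup [set mu K | K in [set K : set S | compact K /\ K `<=` U]] }.

Definition ae_equal (f g : S -> C) := {ae mu, forall s : borel S, f s = g s}.

Definition borel_fun (f : S -> C) :=
  forall U : set C, open U -> measurable (f @^-1` U : set (borel S)).

(* Measurability for the mu-completion of the Borel sigma-algebra. *)
Definition mu_measurable (f : S -> C) :=
  exists2 g : S -> C, borel_fun g & ae_equal f g.

Definition cintegrable (f : S -> C) :=
  mu.-integrable [set: borel S] (fun s => (complex.Re (f s))%:E) /\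
  mu.-integrable [set: borel S] (fun s => (complex.Im (f s))%:E).

(* Only meaningful together with cintegrable, as \int returns a default value
   otherwise. *)
Definition cintegral (f : S -> C) : R[i] :=
  (\int[mu]_(s in [set: borel S]) complex.Re (f s)) +i*
  (\int[mu]_(s in [set: borel S]) complex.Im (f s)).

(* A space M of mu-a.e. classes of functions is given by a map ev choosing a
   representative ev m of each class m; all statements about ev are up to
   mu-null sets, so they do not depend on this choice. *)
Section class_spaces.
Variables (M : completeNormedModType R[i]) (ev : M -> S -> C).

Definition in_space (f : S -> C) := exists m, ae_equal (ev m) f.

(* The class of f as an element of M, with the default value 0 if f does not
   belong to M. *)
Definition class_of (f : S -> C) : M := xget 0 [set m | ae_equal (ev m) f].

Record space_of_classes : Prop := SpaceOfClasses {
  ev_measurable : forall m, mu_measurable (ev m) ;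
  ev_linear : forall (a : R[i]) m n,
    ae_equal (ev (a *: m + n)) (fun s => a * ev m s + ev n s) ;
  ev_inj : forall m, ae_equal (ev m) (fun=> 0) -> m = 0 }.

Record solid_space : Prop := SolidSpace {
  solid_classes : space_of_classes ;
  solid_indic : forall A : set (borel S), measurable A -> (mu A < +oo)%E ->
    in_space \1_A ;
  solid_le : forall f g : S -> C, mu_measurable f -> mu_measurable g ->
    {ae mu, forall s : borel S, `|f s| <= `|g s|} -> in_space g ->
    in_space f /\ `|class_of f| <= `|class_of g| ;
  solid_dominated : forall (f g : S -> C) (f_ : nat -> S -> C),
    in_space f -> in_space g -> (forall n, mu_measurable (f_ n)) ->
    (forall n, {ae mu, forall s : borel S, `|f_ n s| <= `|g s|}) ->
    {ae mu, forall s : borel S, (fun n => f_ n s) @ \oo --> f s} ->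
    (fun n => `|class_of (f_ n) - class_of f|) @ \oo --> (0 : C) }.

(* Multiplication by the characteristic function of A. *)
Definition cutoff (A : set S) (m : M) : M :=
  class_of (fun s => \1_A s * ev m s).

End class_spaces.

(* Integrability is part of the frame identity: it already follows from the
   case u = v, where the integrand is nonnegative, by Cauchy-Schwarz. *)
Definition tight_frame (H : normedModType R[i]) (ip : H -> H -> R[i])
    (w : S -> H) :=
  (forall x' : bop H C, continuous (fun s => x' (w s))) /\
  (forall u v, cintegrable (fun s => ip u (w s) * ip (w s) v) /\
    ip u v = cintegral (fun s => ip u (w s) * ip (w s) v)).

End function_spaces.

Section topological_vector_spaces.
Context {R : realType}.

Definition frechet (G : tvsType R[i]) :=
  [/\ hausdorff_space G, countable_uniformity G &
      forall F : set_system G, ProperFilter F -> cauchy F ->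
        exists x : G, F --> x].

Definition lin_span (V : lmodType R[i]) (A : set V) : set V :=
  [set v | exists n (a : 'I_n -> R[i]) (x : 'I_n -> V),
    (forall k, A (x k)) /\ v = \sum_(k < n) a k *: x k].

Definition total_set (G : tvsType R[i]) (A : set G) := dense (lin_span A).

Definition separable_space (T : topologicalType) :=
  exists2 D : set T, countable D & dense D.

Definition sigma_compact (T : topologicalType) :=
  exists2 K : nat -> set T, (forall n, compact (K n)) & \bigcup_n K n = setT.

(* E is a completion of the subspace D of V, normed by N, and j is its canonical
   map; the values of j outside D are irrelevant. *)
Record is_completion (V : lmodType R[i]) (D : set V) (N : V -> R[i])
    (E : completeNormedModType R[i]) (j : V -> E) : Prop := IsCompletion {
  completion_linear : forall a u v, D u -> D v ->
    j (a *: u + v) = a *: j u + j v ;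
  completion_isometric : forall u, D u -> `|j u| = N u ;
  completion_dense : dense (j @` D) }.

End topological_vector_spaces.

Section coorbit_spaces.
Context {R : realType} {S : ptopologicalType} {G : tvsType R[i]}.
Variables (mu : {measure set (borel S) -> \bar R}) (w : S -> G).
Variables (M : completeNormedModType R[i]) (ev : M -> S -> R[i]^o).

Definition phi (u : antidual G) : S -> R[i]^o := fun s => u (w s).

Definition coorbit : set (antidual G) := [set u | in_space mu ev (phi u)].

Definition coorbit_norm (u : antidual G) : R[i] :=
  `|class_of mu ev (phi u)|.

End coorbit_spaces.

Section banach_spaces.
Context {R : realType} (X : normedModType R[i]).

Definition compact_operator (Y : normedModType R[i]) (T : bop X Y) :=
  precompact (T @` @unit_ball R X).

Definition weakly_null (x : nat -> X) :=
  forall x' : bop X R[i]^o, (fun n => x' (x n)) @ \oo --> (0 : R[i]^o).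

Definition ell1_norm (a : nat -> R[i]^o) : \bar R :=
  (\sum_(0 <= k <oo) (rnorm (a k))%:E)%E.

Definition ell1 : set (nat -> R[i]^o) := [set a | (ell1_norm a < +oo)%E].

(* T is only relevant on ell1. *)
Definition contains_ell1 :=
  exists T : (nat -> R[i]^o) -> X,
    (forall (c : R[i]) a b, ell1 a -> ell1 b ->
       T (c *: a + b) = c *: T a + T b) /\
    exists c d : R, [/\ 0 < c, 0 < d & forall a, ell1 a ->
      (c%:E * ell1_norm a <= (rnorm (T a))%:E <= d%:E * ell1_norm a)%E].

End banach_spaces.

(* Main.v *)
Require Import Defs.
From HB Require Import structures.
From mathcomp Require Import all_boot all_order all_algebra.
From mathcomp Require Import all_classical all_reals all_analysis.
From mathcomp Require Import complex ring lra.

Set Implicit Arguments.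
Unset Strict Implicit.
Unset Printing Implicit Defensive.

Import Order.TTheory GRing.Theory Num.Theory.
Import numFieldNormedType.Exports.

Local Open Scope classical_set_scope.
Local Open Scope ring_scope.
Local Open Scope complex_scope.

(** The theorem splits into three independent equivalences for the family K,
    where Omega is the union of the images S B of the unit ball B of X and
    p x is the supremum of |S x| over S in K.

    First (precompact_familyP), K is a precompact family of compact operators
    if and only if K is bounded, Omega is totally bounded and B is totally
    bounded for the seminorm p. For the converse, a member of K is determined up
    to a small error by its values at a finite p-net of B, and these values lie
    in the totally bounded set Omega.

    Secondly, a bounded subset of the completed coorbit space is totally bounded
    if and only if its members have uniformly small tails outside compact
    subsets of Sigma; this turns the condition on Omega into condition 1. That
    tails of a single element, hence of a totally bounded set, are small is
    dominated convergence (tbounded_coorbit_tails). Conversely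
    (coorbit_tbounded), a bounded sequence of the coorbit space is a sequence of
    functionals u_n that is pointwise bounded on G, hence equicontinuous by
    Baire's theorem. On a compact L the functions s |-> u_n (w s) are uniformly
    bounded, by the Banach-Steinhaus theorem, and a subsequence of them converges
    pointwise on L (antidual_subsequence): a diagonal subsequence converges at
    the points of a countable subset of L, and as H is separable, a functional
    is determined on w L by its values at countably many points. Dominated
    convergence then gives convergence in M of the restrictions to L, and
    condition 1 controls what is outside L.

    Thirdly, the condition on p is equivalent to condition 2, and to condition
    2' if X does not contain a copy of l1. Condition 2 (null_majorantP) is
    Grothendieck's description of compact sets: if B is p-precompact, then the
    functionals dominated by p form a totally bounded set in X', which lies in
    the closed absolutely convex hull of a null sequence, and the Hahn-Banach
    theorem recovers p from these functionals. For condition 2'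
    (weakly_null_supP), a p-separated sequence in B would have a weakly Cauchy
    subsequence by Rosenthal's theorem, whose consecutive differences are weakly
    null but not small for p. Rosenthal's theorem for complex scalars (rosenthal)
    follows from a combinatorial splitting argument that makes pairs of small
    discs independent along a subsequence, and from Dor's observation that two
    opposite patterns of values in such discs bound the norm of a linear
    combination from below. *)

(** * Real-valued norms on complex normed spaces *)

Section real_norm.
Context {R : realType}.

Lemma ltr0c (r : R) : (0 < r%:C) = (0 < r).
Proof. by rewrite -[0 in LHS]/(0%:C) ltcR. Qed.

Section normed_module.
Context {V : normedModType R[i]}.
Implicit Types (x y : V) (A : set V).

Lemma rnorm_ge0 x : 0 <= rnorm x.
Proof. by rewrite -lecR -normE normr_ge0. Qed.

Lemma rnorm0 : rnorm (0 : V) = 0.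
Proof. by rewrite /rnorm normr0. Qed.

Lemma rnorm0_eq0 x : rnorm x = 0 -> x = 0.
Proof. by move=> x0; apply/eqP; rewrite -normr_eq0 normE x0. Qed.

Lemma rnorm_gt0 x : x != 0 -> 0 < rnorm x.
Proof.
move=> x0; rewrite lt_neqAle rnorm_ge0 andbT eq_sym.
by apply: contra_neq x0 => /rnorm0_eq0.
Qed.

Lemma rnorm_small_eq0 x : (forall e : R, 0 < e -> rnorm x <= e) -> x = 0.
Proof.
move=> xe; apply/rnorm0_eq0/eqP; rewrite eq_le rnorm_ge0 andbT.
by apply/ler_addgt0Pl => e e0; rewrite addr0 xe.
Qed.

Lemma rnormN x : rnorm (- x) = rnorm x.
Proof. by rewrite /rnorm normrN. Qed.

Lemma rdistC x y : rnorm (x - y) = rnorm (y - x).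
Proof. by rewrite -rnormN opprB. Qed.

Lemma ler_rnormD x y : rnorm (x + y) <= rnorm x + rnorm y.
Proof. by rewrite -lecR rmorphD/= -!normE ler_normD. Qed.

Lemma ler_rdistD z x y : rnorm (x - y) <= rnorm (x - z) + rnorm (z - y).
Proof. by rewrite (le_trans _ (ler_rnormD _ _))// addrA subrK. Qed.

Lemma ler_rnormB x y : rnorm (x - y) <= rnorm x + rnorm y.
Proof. by rewrite (le_trans (ler_rnormD _ _))// rnormN. Qed.

Lemma lerB_rnorm x y : rnorm x - rnorm y <= rnorm (x - y).
Proof. by rewrite lerBlDr (le_trans _ (ler_rnormD _ _))// subrK. Qed.

Lemma rnorm_sum (I : Type) (s : seq I) (P : pred I) (F : I -> V) :
  rnorm (\sum_(i <- s | P i) F i) <= \sum_(i <- s | P i) rnorm (F i).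
Proof.
elim/big_rec2 : _ => [|i r x _ xr]; first by rewrite rnorm0.
by rewrite (le_trans (ler_rnormD _ _))// lerD2l.
Qed.

Lemma rnormZ (a : R[i]) x : rnorm (a *: x) = rnorm (a : R[i]^o) * rnorm x.
Proof.
apply: (@complexI R); rewrite rmorphM/= -!normE normrZ.
by [].
Qed.

Lemma rnormZr (r : R) x : 0 <= r -> rnorm (r%:C *: x) = r * rnorm x.
Proof.
move=> r0; rewrite rnormZ; congr (_ * _).
by rewrite /rnorm ger0_norm// ler0c.
Qed.

Lemma unit_ballE x : unit_ball x <-> rnorm x <= 1.
Proof. by rewrite /unit_ball/= -lecR -normE. Qed.

Lemma nbhs_rnormP x A :
  nbhs x A <-> exists2 e : R, 0 < e & forall y, rnorm (x - y) < e -> A y.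
Proof.
split=> [/nbhs_ballP[e /= e0 eA]|[e e0 eA]].
  have eE : e = (complex.Re e)%:C by rewrite RRe_real// gtr0_real.
  exists (complex.Re e); first by rewrite -ltcR -eE.
  by move=> y xy; apply: eA; rewrite -ball_normE/= normE eE ltcR.
apply/nbhs_ballP; exists e%:C => /=; first by rewrite ltr0c.
by move=> y; rewrite -ball_normE/= normE ltcR; exact: eA.
Qed.

Lemma cvg_rnormP (F : set_system V) x : Filter F ->
  F --> x <-> forall e : R, 0 < e -> \forall y \near F, rnorm (x - y) <= e.
Proof.
move=> FF; split=> [Fx e e0|Fx A /nbhs_rnormP[e e0 eA]].
  by apply: Fx; apply/nbhs_rnormP; exists e => // y /ltW.
rewrite nbhs_filterE; have e20 : 0 < e / 2 by rewrite divr_gt0.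
near=> y; apply: eA; suff : rnorm (x - y) <= e / 2 by lra.
by near: y; exact: Fx.
Unshelve. all: by end_near. Qed.

Lemma cvg_rnorm_near (F : set_system V) {FF : Filter F} x : F --> x ->
  forall e : R, 0 < e -> F [set y | rnorm (x - y) <= e].
Proof. by move=> /cvg_rnormP Fx e /Fx. Qed.

Lemma cauchy_rnorm (F : set_system V) : ProperFilter F ->
  (forall e : R, 0 < e ->
    exists2 B, F B & forall x y, B x -> B y -> rnorm (x - y) <= e) ->
  cauchy F.
Proof.
move=> FF Fe; apply/cauchy_ballP => e e0.
have eE : e = (complex.Re e)%:C by rewrite RRe_real// gtr0_real.
have re0 : 0 < complex.Re e / 2 by rewrite divr_gt0// -ltcR -eE.
have [B FB Be] := Fe _ re0; exists (B, B); first by [].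
move=> [x y] [/= Bx By]; rewrite -ball_normE/= normE eE ltcR.
by have := Be _ _ Bx By; lra.
Qed.

Lemma rnorm_cauchy (F : set_system V) : ProperFilter F -> cauchy F ->
  forall e : R, 0 < e ->
    exists2 B, F B & forall x y, B x -> B y -> rnorm (x - y) <= e.
Proof.
move=> FF /cauchy_ballP Fc e e0.
have /Fc[[B1 B2]/= [FB1 FB2] B12] : 0 < (e / 2)%:C by rewrite ltr0c divr_gt0.
exists (B1 `&` B2); first exact: filterI.
move=> x y [Bx _] [_ By].
have /B12 : (B1 `*` B2) (x, y) by [].
by rewrite -ball_normE/= normE ltcR; lra.
Qed.

End normed_module.

Lemma cvgn_rnormP {V : normedModType R[i]} (u : nat -> V) x :
  u @ \oo --> x <->
  forall e : R, 0 < e -> exists N, forall n, (N <= n)%N -> rnorm (x - u n) <= e.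
Proof.
rewrite cvg_rnormP; split=> ux e /ux.
  by move=> [N _ uN]; exists N => n /uN.
by move=> [N uN]; exists N.
Qed.

Lemma continuous_rnorm (V : normedModType R[i]) (T : topologicalType)
    (f : T -> V) x :
  {for x, continuous f} <-> forall e : R, 0 < e ->
    \forall y \near x, rnorm (f x - f y) <= e.
Proof. by rewrite /prop_for /continuous_at cvg_rnormP. Qed.

Lemma linear_bounded_rnorm (V W : normedModType R[i]) (f : {linear V -> W}) :
  continuous f <-> exists2 C : R, 0 < C & forall x, rnorm (f x) <= C * rnorm x.
Proof.
split=> [/linear_bounded_continuous/linear_boundedP/pinfty_ex_gt0[r r0 fr]|].
  have rE : r = (complex.Re r)%:C by rewrite RRe_real// gtr0_real.
  exists (complex.Re r); first by rewrite -ltcR -rE.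
  by move=> x; rewrite -lecR rmorphM/= -rE -!normE.
move=> [C C0 fC] x; apply/continuous_rnorm => e e0.
apply/nbhs_rnormP; exists (e / C); first by rewrite divr_gt0.
move=> y; rewrite ltr_pdivlMr// -linearB => xy.
by rewrite (le_trans (fC _))// mulrC ltW.
Qed.

End real_norm.

(** * Total boundedness and ultrafilters *)

Lemma ultra_fmap (T U : Type) (f : T -> U) (F : set_system T) :
  UltraFilter F -> UltraFilter (fmap f F).
Proof.
move=> FU; split; first exact: fmap_proper_filter.
move=> G GF FG; apply/seteqP; split=> // A GA.
have [//|FA] := in_ultra_setVsetC (f @^-1` A) FU.
have /(filterI GA) : G (~` A) by exact: FG.
by rewrite setICr => /filter_not_empty.
Qed.

Lemma ultra_seq (T : Type) (I : eqType) (s : seq I) (P : I -> set T)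
    (F : set_system T) :
  UltraFilter F -> F [set x | exists2 i, i \in s & P i x] ->
  exists2 i, i \in s & F (P i).
Proof.
move=> FU; elim: s => [|i s ih].
  by move=> /filter_ex[x []].
move=> Fs; have [FPi|nFPi] := in_ultra_setVsetC (P i) FU.
  by exists i => //; rewrite mem_head.
have /ih[j js FPj] : F [set x | exists2 i, i \in s & P i x].
  apply: filterS2 nFPi Fs => x /= nPix [j].
  by rewrite in_cons => /predU1P[->|] // js Pjx; exists j.
by exists j => //; rewrite in_cons js orbT.
Qed.

Section total_boundedness.
Context {R : realType} {T : eqType}.

(** The semidistances needed below come from different norms on the same space,
    so total boundedness is relative to d rather than to a uniformity. *)
Record semidistance (d : T -> T -> R) : Prop := Semidistance {
  semid_refl : forall x, d x x = 0 ;
  semid_sym : forall x y, d x y = d y x ;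
  semid_tri : forall z x y, d x y <= d x z + d z y }.

Definition tbounded (d : T -> T -> R) (A : set T) := forall e : R, 0 < e ->
  exists2 s : seq T, (forall y, y \in s -> A y) &
    forall x, A x -> exists2 y, y \in s & d x y <= e.

Variables (d : T -> T -> R) (dP : semidistance d).
Implicit Types A : set T.

(** Finite nets compose badly with products and images, ultrafilters compose
    well; total boundedness means that ultrafilters on A are Cauchy. *)
Lemma tbounded_ultra A (F : set_system T) : tbounded d A ->
  UltraFilter F -> F A -> forall e : R, 0 < e ->
  exists2 B, F B & forall x y, B x -> B y -> d x y <= e.
Proof.
move=> tbA FU FA e e0; have e20 : 0 < e / 2 by rewrite divr_gt0.
have [s sA netA] := tbA _ e20.
have [|y ys Fy] := @ultra_seq _ _ s (fun y x => d x y <= e / 2) _ FU.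
  by apply: filterS FA => x /netA.
exists [set x | d x y <= e / 2] => // x z /= xy zy.
have := semid_tri dP y x z; rewrite [d y z](semid_sym dP); lra.
Qed.

Lemma ultra_tbounded A :
  (forall F : set_system T, UltraFilter F -> F A -> forall e : R, 0 < e ->
    exists2 B, F B & forall x y, B x -> B y -> d x y <= e) ->
  tbounded d A.
Proof.
move=> uA e e0; apply: contrapT => nonet.
pose far (s : seq T) := [set x | A x /\ forall y, y \in s -> ~ d x y <= e].
pose G := filter_from [set s : seq T | forall y, y \in s -> A y] far.
have farI s t : far (s ++ t) `<=` far s `&` far t.
  move=> x [Ax xst]; split; split=> // y ys; apply: xst.
    by rewrite mem_cat ys.
  by rewrite mem_cat ys orbT.
have GP : ProperFilter G.
  apply: filter_from_proper.
    apply: filter_from_filter; first by exists [::].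
    move=> s t sA tA; exists (s ++ t); last exact: farI.
    by move=> y; rewrite mem_cat => /orP[/sA|/tA].
  move=> s sA; apply: contrapT => s0; apply: nonet; exists s => // x Ax.
  apply: contrapT => xs; apply: s0; exists x; split=> // y ys xy.
  by apply: xs; exists y.
have [F [FU GF]] := ultraFilterLemma GP.
have FA : F A by apply: GF; exists [::] => // x [].
have [B FB Be] := uA F FU FA e e0.
have [x [Ax Bx]] : (A `&` B) !=set0 by apply: (@filter_ex _ F); exact: filterI.
have /(filterI FB)/filter_ex[z [Bz [Az zx]]] : F (far [:: x]).
  apply: GF; exists [:: x] => // y.
  by rewrite mem_seq1 => /eqP ->.
by apply: (zx x); [rewrite mem_head|exact: Be].
Qed.

(** Without a finite net, a greedy choice produces an infinite separated
    sequence. *)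
Lemma separated_tbounded A :
  (forall e : R, 0 < e -> forall x : nat -> T, (forall n, A (x n)) ->
    exists m n, (m < n)%N /\ d (x n) (x m) <= e) ->
  tbounded d A.
Proof.
move=> sepA e e0; apply: contrapT => nonet.
have ext (s : seq T) : exists x, (forall y, y \in s -> A y) ->
    A x /\ forall y, y \in s -> ~ d x y <= e.
  apply: contrapT => /forallNP nx; apply: nonet; exists s.
    by move=> y ys; apply: contrapT => nAy; apply: (nx y) => /(_ _ ys).
  move=> x Ax; apply: contrapT => xs; apply: (nx x) => sA; split=> // y ys xy.
  by apply: xs; exists y.
have [f fP] := choice ext.
pose s := fix s n := if n is m.+1 then f (s m) :: s m else [::].
have sA n : forall y, y \in s n -> A y.
  elim: n => [//|n ih] y /=; rewrite in_cons => /predU1P[->|]; last exact: ih.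
  by have [] := fP _ ih.
have ss m n : (m < n)%N -> f (s m) \in s n.
  elim: n => [//|n ih]; rewrite ltnS leq_eqVlt => /predU1P[->|/ih] /=.
    by rewrite mem_head.
  by rewrite in_cons => ->; rewrite orbT.
have [|m [n [mn]]] := sepA _ e0 (fun n => f (s n)).
  by move=> n; have [] := fP _ (sA n).
have [_ /(_ _ (ss _ _ mn))] := fP _ (sA n).
by [].
Qed.

Lemma tboundedS A B : A `<=` B -> tbounded d B -> tbounded d A.
Proof.
move=> AB tbB; apply: ultra_tbounded => F FU FA.
by apply: (@tbounded_ultra B) => //; exact: filterS FA.
Qed.

End total_boundedness.

Definition ucomplete (T : uniformType) :=
  forall F : set_system T, ProperFilter F -> cauchy F -> exists x : T, F --> x.

Section normed_total_boundedness.
Context {R : realType} {V : normedModType R[i]}.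
Implicit Types A : set V.

Definition rdist (x y : V) : R := rnorm (x - y).

Lemma rdist_semidistance : semidistance rdist.
Proof.
split=> [x|x y|z x y]; first by rewrite /rdist subrr rnorm0.
  exact: rdistC.
exact: ler_rdistD.
Qed.

Lemma precompact_tbounded A : precompact A -> tbounded rdist A.
Proof.
rewrite precompactE compact_ultra => cA.
apply: ultra_tbounded => F FU FA e e0.
have [|x [_ Fx]] := cA F FU; first exact: filterS (@subset_closure _ A) FA.
have e20 : 0 < e / 2 by rewrite divr_gt0.
have FB : F [set y | rnorm (x - y) <= e / 2] by exact: cvg_rnorm_near.
exists [set y | rnorm (x - y) <= e / 2] => // y z /= xy xz.
by rewrite (le_trans (ler_rdistD x _ _))// rdistC; lra.
Qed.

Lemma closure_rnormP A x :
  closure A x <-> forall e : R, 0 < e -> exists2 y, A y & rnorm (x - y) <= e.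
Proof.
split=> [Ax e e0|Ax B /nbhs_rnormP[e e0 eB]].
  have /Ax[y [Ay]] : nbhs x [set y | rnorm (x - y) < e].
    by apply/nbhs_rnormP; exists e.
  by move=> /ltW; exists y.
have [|y Ay xy] := Ax (e / 2); first by rewrite divr_gt0.
by exists y; split => //; apply: eB; lra.
Qed.

Lemma tbounded_precompact A : ucomplete V -> tbounded rdist A -> precompact A.
Proof.
move=> cV tbA; rewrite precompactE compact_ultra => F FU FA.
have tbcA : tbounded rdist (closure A).
  move=> e e0; have e20 : 0 < e / 2 by rewrite divr_gt0.
  have [s sA net] := tbA _ e20; exists s.
    by move=> y /sA; exact: subset_closure.
  move=> x /closure_rnormP/(_ _ e20)[y /net[z zs yz] xy].
  exists z => //; apply: le_trans (ler_rdistD y _ _) _.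
  by move: yz xy; rewrite /rdist; lra.
have [|x Fx] := cV F _.
  apply: cauchy_rnorm => e e0.
  exact: (tbounded_ultra rdist_semidistance tbcA).
exists x; split=> //; apply/closure_rnormP => e e0.
have e20 : 0 < e / 2 by rewrite divr_gt0.
have FB : F [set y | rnorm (x - y) <= e / 2] by exact: cvg_rnorm_near.
have [y [/closure_rnormP/(_ _ e20)[z Az yz] xy]] : (closure A `&`
    [set y | rnorm (x - y) <= e / 2]) !=set0.
  by apply: (@filter_ex _ F); exact: filterI.
by exists z => //; apply: le_trans (ler_rdistD y _ _) _; move: xy => /=; lra.
Qed.

End normed_total_boundedness.

Lemma complete_ucomplete (T : completeType) : ucomplete T.
Proof. by move=> F FF /cauchy_cvg Fc; exists (lim F). Qed.

Section complex_plane.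
Context {R : realType}.
Local Notation C := (R[i]^o).

Lemma rnormCE (a b : R) : rnorm (a +i* b : C) <= `|a| + `|b|.
Proof.
have -> : (a +i* b : C) = (a%:C : C) + ((0 +i* b) : C).
  by apply/eqP; rewrite eq_complex/= addr0 add0r !eqxx.
rewrite (le_trans (ler_rnormD _ _))// lerD// /rnorm normc_def/=.
  by rewrite expr0n/= addr0 sqrtr_sqr.
by rewrite expr0n/= add0r sqrtr_sqr.
Qed.

Lemma rnormC_Re (z : C) : `|complex.Re z| <= rnorm z.
Proof.
case: z => a b; rewrite /rnorm normc_def/= -sqrtr_sqr ler_wsqrtr//.
by rewrite lerDl sqr_ge0.
Qed.

Lemma rnormC_Im (z : C) : `|complex.Im z| <= rnorm z.
Proof.
case: z => a b; rewrite /rnorm normc_def/= -sqrtr_sqr ler_wsqrtr//.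
by rewrite lerDr sqr_ge0.
Qed.

Lemma rnormM (a b : C) : rnorm (a * b : C) = rnorm a * rnorm b.
Proof. exact: (@rnormZ _ C a b). Qed.

Lemma rnorm1 : rnorm (1 : C) = 1.
Proof. by rewrite /rnorm normr1. Qed.

Lemma rnormC (r : R) : rnorm (r%:C : C) = `|r|.
Proof. by rewrite /rnorm normc_def/= expr0n/= addr0 sqrtr_sqr. Qed.

Lemma rnorm_conj (z : C) : rnorm ((z : R[i])^*%R : C) = rnorm z.
Proof. by rewrite /rnorm norm_conjC. Qed.

Lemma ultra_disc (F : set_system C) (r : R) : UltraFilter F ->
  F [set z | rnorm z <= r] -> exists z : C, F --> z.
Proof.
move=> FU Fr.
have cvg_part (p : C -> R) : (forall z, `|p z| <= rnorm z) ->
    exists a : R, p @ F --> a.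
  move=> pz; have Fp : fmap p F (`[- r, r]%classic).
    apply: (@filterS _ F _ _ _ _ Fr) => z /= zr; rewrite in_itv/= -ler_norml.
    by rewrite (le_trans (pz z)).
  have := @segment_compact R (- r) r; rewrite compact_ultra.
  by move=> /(_ _ (ultra_fmap p FU) Fp)[a [_ Fa]]; exists a.
have [a Fa] := cvg_part _ rnormC_Re.
have [b Fb] := cvg_part _ rnormC_Im.
exists (a +i* b : C); apply/cvg_rnormP => e e0.
have e20 : 0 < e / 2 by rewrite divr_gt0.
move/cvgrPdist_le : Fa => /(_ _ e20) Fa.
move/cvgrPdist_le : Fb => /(_ _ e20) Fb.
apply: filterS2 Fa Fb => -[x y] /= ax bY.
have -> : (a +i* b : C) - (x +i* y : C) = ((a - x) +i* (b - y) : C) by [].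
by apply: le_trans (rnormCE _ _) _; lra.
Qed.

Lemma disc_tbounded (r : R) : tbounded rdist [set z : C | rnorm z <= r].
Proof.
apply: ultra_tbounded => F FU /(ultra_disc FU)[z Fz] e e0.
have e20 : 0 < e / 2 by rewrite divr_gt0.
have FB : F [set y | rnorm (z - y) <= e / 2] by exact: cvg_rnorm_near.
exists [set y | rnorm (z - y) <= e / 2] => // x y /= zx zy.
by apply: le_trans (ler_rdistD z _ _) _; rewrite rdistC; lra.
Qed.

Lemma complex_ucomplete : ucomplete C.
Proof.
move=> F FF Fc; have [B FB Be] := rnorm_cauchy FF Fc ltr01.
have [b Bb] := filter_ex FB; have [G [GU FG]] := ultraFilterLemma FF.
have [|z Gz] := @ultra_disc G (rnorm b + 1) GU.
  apply: FG; apply: filterS FB => x Bx /=.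
  by have := lerB_rnorm x b; have := Be _ _ Bx Bb; lra.
exists z; apply/cvg_rnormP => e e0.
have e20 : 0 < e / 2 by rewrite divr_gt0.
have [D FD De] := rnorm_cauchy FF Fc e20.
have [y [Dy zy]] : (D `&` [set y | rnorm (z - y) <= e / 2]) !=set0.
  apply: (@filter_ex _ G); apply: filterI; first exact: FG.
  exact: cvg_rnorm_near Gz _ e20.
apply: filterS FD => x Dx; apply: le_trans (ler_rdistD y _ _) _.
by move: zy => /=; have := De _ _ Dy Dx; lra.
Qed.

End complex_plane.

(** * Baire's theorem, uniform boundedness, diagonal extraction, completeness of operator spaces *)

(** Stated for complete uniform spaces so as to cover normed spaces as well as
    Frechet spaces, whose uniformity is not assumed to be invariant under
    translations. *)
Lemma baire (T : uniformType) (x0 : T) (F : nat -> set T) :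
  countable_uniformity T -> ucomplete T ->
  (forall n, closed (F n)) -> (forall x, exists n, F n x) ->
  exists n (x : T), nbhs x (F n).
Proof.
move=> /countable_uniformityP[E Esub entE] cT Fcl Fcov.
apply: contrapT => noint.
have step n (U : set T) : exists V : set T, U° !=set0 ->
    [/\ V° !=set0, closure V `<=` U, closure V `<=` ~` F n &
        forall x y, V x -> V y -> E n (x, y)].
  apply: contrapT => nV; apply: noint.
  have [U0|nU0] := pselect (U° !=set0); last by exfalso; apply: nV; exists U.
  have [[x [Ux nFx]]|] := pselect ((U° `&` ~` F n) !=set0); last first.
    move=> UF; case: U0 => x Ux; exists n, x.
    have : nbhs x U° by apply/nbhs_interior.
    by apply: filterS => y Uy; apply: contrapT => nFy; apply: UF; exists y.
  exfalso; apply: nV; have UFx : nbhs x (U `&` ~` F n).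
    apply: filterI => //; apply: open_nbhs_nbhs; split=> //.
    exact: closed_openC.
  have [W Wx WUF] := uniform_regular UFx.
  have [D entD DE] := entourage_split_ex (entE n).
  pose V := W `&` (xsection D x `&` xsection (D^-1)%relation x).
  have nV : nbhs x V.
        apply: filterI => //; apply: filterI; apply: nbhs_entourage => //.
  have VW : closure V `<=` closure W by apply: closureS => y [].
  exists V => _; split.
  - by exists x.
  - by move=> y /VW /WUF[].
  - by move=> y /VW /WUF[].
  - move=> y z [_ [_ /xsectionP yx]] [_ [/xsectionP xz _]].
    by apply: DE; exists x.
have [f fP] := choice (fun nU : nat * set T => step nU.1 nU.2).
pose V := fix V n := if n is m.+1 then f (m, V m) else setT.
have V0 n : (V n)° !=set0.
  elim: n => [|n ih]; last by have [] := fP (n, V n) ih.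
  by exists x0; rewrite /= interiorT.
have VP n := fP (n, V n) (V0 n).
have Vdecr m n : (m <= n)%N -> V n `<=` V m.
  elim: n => [|n ih]; first by rewrite leqn0 => /eqP ->.
  rewrite leq_eqVlt => /predU1P[->//|/ih]; apply: subset_trans.
  by have [_ + _ _] := VP n; apply: subset_trans; exact: subset_closure.
pose G := filter_from [set: nat] V.
have GP : ProperFilter G.
  apply: filter_from_proper.
    apply: filter_from_filter; first by exists 0%N.
    move=> m n _ _; exists (maxn m n) => // x Vx.
    by split; apply: Vdecr Vx; [exact: leq_maxl|exact: leq_maxr].
  by move=> n _; case: (V0 n) => x /interior_subset; exists x.
have Gc : cauchy G.
  move=> A /Esub[N ENA]; exists (V N.+1, V N.+1).
    by split; exists N.+1.
  by move=> [x y] [/= Vx Vy]; apply: ENA; have [_ _ _] := VP N; exact.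
have [x Gx] := cT G GP Gc.
have [n Fnx] := Fcov x; have [_ _ /(_ x) + _] := VP n; apply => // B Bx.
have [k _ VkB] := Gx _ Bx.
have [y Vy] : V (maxn k n.+1) !=set0.
  by case: (V0 (maxn k n.+1)) => y /interior_subset; exists y.
exists y; split; last by apply: VkB; apply: Vdecr Vy; exact: leq_maxl.
by have := @Vdecr n.+1 (maxn k n.+1) (leq_maxr _ _) y Vy.
Qed.

Section uniform_boundedness.
Context {R : realType}.

(** By Baire's theorem some sublevel set of the supremum of Q is a neighborhood
    of a point, and translation and dilation carry it to a neighborhood of 0.
    Real functions q cover the absolute values of linear and of antilinear
    functionals alike. *)
Lemma uniform_boundedness (T : tvsType R[i]) (Q : set (T -> R)) :
  countable_uniformity T -> ucomplete T ->
  (forall q, Q q -> [/\ continuous q, forall x y, q (x - y) <= q x + q y &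
     forall (a : R[i]) x, q (a *: x) = rnorm (a : R[i]^o) * q x]) ->
  (forall x, exists M, forall q, Q q -> q x <= M) ->
  exists2 U : set T, nbhs 0 U & forall q x, Q q -> U x -> q x <= 1.
Proof.
move=> cuT cT Qsemi Qbnd.
pose F (n : nat) := \bigcap_(q in Q) [set x : T | q x <= n%:R].
have Fcl n : closed (F n).
  apply: closed_bigI => q /Qsemi[cq _ _].
  by apply: (@closed_comp _ _ q [set r | r <= n%:R]); [move=> x _; exact: cq|exact: closed_le].
have Fcov x : exists n, F n x.
  have [M QM] := Qbnd x; exists (Num.truncn M).+1 => q Qq /=.
  by rewrite (le_trans (QM q Qq))// ltW// truncnS_gt.
have [n [x Fx]] := baire 0 cuT cT Fcl Fcov.
pose c : R := n%:R + n%:R + 1.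
have c0 : 0 < c by rewrite ltr_wpDl// addr_ge0.
exists [set y | F n (c%:C *: y + x)].
  suff : (fun y : T => c%:C *: y + x) @ nbhs 0 --> x by apply.
  rewrite -[X in _ --> X]add0r -[X in X + x](scaler0 _ c%:C).
  apply: (@continuous_comp T (T * T)%type T (fun y => (c%:C *: y, x))
    (fun z => z.1 + z.2)); last exact: add_continuous.
  apply: cvg_pair => /=; last exact: cvg_cst.
  apply: (@continuous_comp T (R[i]^o * T)%type T (fun y => (c%:C, y))
    (fun z => z.1 *: z.2)); last exact: scale_continuous.
  by apply: (@cvg_pair _ _ _ _ (nbhs (c%:C : R[i]^o))); [exact: cvg_cst|exact: cvg_id].
move=> q y Qq Fy; have [cq qB qZ] := Qsemi q Qq.
have := qB (c%:C *: y + x) x; rewrite addrK qZ rnormC (gtr0_norm c0).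
have := Fy q Qq; have := nbhs_singleton Fx q Qq => /= qx qyx.
move=> cq1; rewrite -(ler_pM2l c0) mulr1; move: cq1 qx qyx; rewrite /c; lra.
Qed.

Lemma normed_countable_uniformity (V : normedModType R[i]) :
  countable_uniformity V.
Proof.
apply/countable_uniformityP.
exists (fun n => [set xy : V * V | ball xy.1 (n.+1%:R^-1)%:C xy.2]).
  move=> A; rewrite -entourage_ballE => -[e /= e0 eA].
  have eE : e = (complex.Re e)%:C by rewrite RRe_real// gtr0_real.
  have [n ne] : exists n : nat, n.+1%:R^-1 < complex.Re e.
    have [|N] := @ltr_add_invr R 0 (complex.Re e); first by rewrite -ltr0c -eE.
    by rewrite add0r; exists N.
  exists n => -[x y] /= xy; apply: eA => /=.
  by apply: le_ball xy; rewrite eE lecR ltW.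
move=> n; rewrite -entourage_ballE; exists (n.+1%:R^-1)%:C => //=.
by rewrite ltr0c.
Qed.

Lemma banach_steinhaus (V : normedModType R[i]) (Q : set (V -> R)) :
  ucomplete V ->
  (forall q, Q q -> [/\ continuous q, forall x y, q (x - y) <= q x + q y &
     forall (a : R[i]) x, q (a *: x) = rnorm (a : R[i]^o) * q x]) ->
  (forall x, exists M, forall q, Q q -> q x <= M) ->
  exists2 C : R, 0 < C & forall q x, Q q -> q x <= C * rnorm x.
Proof.
move=> cV Qsemi Qbnd.
have [U U0 QU] := uniform_boundedness (normed_countable_uniformity V) cV
  Qsemi Qbnd.
have [e e0 eU] := (nbhs_rnormP _ _).1 U0.
exists (2 / e) => [|q x Qq]; first by rewrite divr_gt0.
have [_ _ qZ] := Qsemi q Qq.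
have [->|x0] := eqVneq x 0.
  by rewrite -[X in q X](scale0r 0) qZ !rnorm0 mul0r mulr0.
have rx0 := rnorm_gt0 x0.
pose c := e / 2 / rnorm x.
have c0 : 0 < c by rewrite !divr_gt0.
have : q (c%:C *: x) <= 1.
  apply: QU => //; apply: eU; rewrite sub0r rnormN (rnormZr _ (ltW c0)).
  by rewrite /c divfK ?gt_eqF//; lra.
rewrite qZ rnormC (gtr0_norm c0) -ler_pdivlMl// mulr1.
by rewrite /c !invfM !invrK [e^-1 * 2]mulrC.
Qed.

End uniform_boundedness.

Lemma eventually_bounded {R : realDomainType} (u : nat -> R) N (B : R) :
  (forall n, (N <= n)%N -> u n <= B) ->
  exists2 D : R, 0 <= D & forall n, u n <= D.
Proof.
move=> uB; have S0 (P : pred 'I_N) : 0 <= \sum_(n < N | P n) `|u n|.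
  by rewrite sumr_ge0.
exists (`|B| + \sum_(n < N) `|u n|) => [|n]; first by rewrite addr_ge0.
have [nN|/uB un] := ltnP n N; last first.
  by rewrite (le_trans un)// (le_trans (ler_norm B))// lerDl.
rewrite (le_trans (ler_norm _))// (bigD1 (Ordinal nN))//= addrCA lerDl.
by rewrite addr_ge0.
Qed.

Section infinite_sets.

Definition unbounded (M : set nat) := forall N, exists2 n, (N <= n)%N & M n.

Lemma unboundedT : unbounded setT.
Proof. by move=> N; exists N. Qed.

Lemma unboundedS (M M' : set nat) : M `<=` M' -> unbounded M -> unbounded M'.
Proof. by move=> MM' uM N; have [n Nn /MM'] := uM N; exists n. Qed.

(** The diagonal of a decreasing sequence of infinite sets is contained in each
    of them up to a finite set, which is why the properties have to pass to
    almost subsets. *)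
Lemma diagonal_extraction (I : countType) (Q : I -> set nat -> Prop) :
  (forall i M M', Q i M ->
     (exists N, forall n, (N <= n)%N -> M' n -> M n) -> Q i M') ->
  (forall i M, unbounded M -> exists2 M', M' `<=` M & unbounded M' /\ Q i M') ->
  forall M, unbounded M ->
    exists2 M', M' `<=` M & unbounded M' /\ forall i, Q i M'.
Proof.
move=> QS Qex M uM.
have step (kM : nat * set nat) : exists M', unbounded kM.2 ->
    [/\ M' `<=` kM.2, unbounded M' &
        forall i, @unpickle I kM.1 = Some i -> Q i M'].
  case: kM => k A /=; case: (unpickle k) => [i|]; last by exists A => uA; split.
  have [uA|nuA] := pselect (unbounded A); last by exists A.
  by have [M' M'A [uM' QM']] := Qex i A uA; exists M' => _; split=> // j [<-].
have [f fP] := choice step.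
pose D := fix D k := if k is l.+1 then f (l, D l) else M.
have uD k : unbounded (D k) by elim: k => [//|k ih]; have [] := fP (k, D k) ih.
have DP k := fP (k, D k) (uD k).
have Ddecr m n : (m <= n)%N -> D n `<=` D m.
  elim: n => [|n ih]; first by rewrite leqn0 => /eqP ->.
  rewrite leq_eqVlt => /predU1P[->//|/ih]; apply: subset_trans.
  by have [] := DP n.
have pick k : exists n, (k <= n)%N /\ D k n.
  by have [n kn Dn] := uD k k; exists n.
have [g gP] := choice pick.
exists (range g); first by move=> _ [k _ <-]; apply: (@Ddecr 0%N k) => //; case: (gP k).
split; first by move=> N; exists (g N); [case: (gP N)|exists N].
move=> i; pose k := (pickle i).+1.
have [_ _ Qk] := DP (pickle i).
apply: (QS i (D k)); first by apply: Qk; rewrite /= pickleK.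
exists (\max_(j < k) (g j).+1) => n Nn [j _ gj].
have [jk|kj] := ltnP j k; last by rewrite -gj; apply: Ddecr kj _ _; case: (gP j).
exfalso; have := leq_trans (leq_bigmax (Ordinal jk)) Nn.
by rewrite /= gj ltnn.
Qed.

Lemma unbounded_enum (M : set nat) : unbounded M ->
  exists e : nat -> nat, (forall k, M (e k)) /\ forall k, (e k < e k.+1)%N.
Proof.
move=> uM; have pick N : exists n, (N <= n)%N /\ M n.
  by have [n] := uM N; exists n.
have [g gP] := choice pick.
pose e := fix e k := if k is l.+1 then g (e l).+1 else g 0%N.
exists e; split=> [[|k]|k] /=; first by case: (gP 0%N).
  by case: (gP (e k).+1).
by case: (gP (e k).+1).
Qed.

Lemma incr_ltn (e : nat -> nat) : (forall k, (e k < e k.+1)%N) ->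
  forall m n, (m < n)%N -> (e m < e n)%N.
Proof.
move=> einc m; elim=> [//|n ih]; rewrite ltnS leq_eqVlt => /predU1P[->//|/ih].
by move/ltn_trans; exact.
Qed.

Lemma incr_geq (e : nat -> nat) : (forall k, (e k < e k.+1)%N) ->
  forall k, (k <= e k)%N.
Proof. by move=> einc; elim=> // k ih; exact: leq_ltn_trans (einc k). Qed.

Lemma unbounded_pigeonhole (I : eqType) (s : seq I) (M : set nat)
    (P : I -> set nat) :
  unbounded M -> (forall n, M n -> exists2 i, i \in s & P i n) ->
  exists2 i, i \in s & unbounded (M `&` P i).
Proof.
move=> uM; elim: s M uM => [|i s ih] M uM MP.
  by have [n _ /MP[]] := uM 0%N.
have [uMi|nuMi] := pselect (unbounded (M `&` P i)).
  by exists i => //; rewrite mem_head.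
have [N NP] : exists N, forall n, (N <= n)%N -> M n -> ~ P i n.
  move/existsNP: nuMi => [N /forall2NP NP]; exists N => n Nn Mn Pin.
  by case: (NP n) => [/(_ Nn)|]; last apply.
have [||j js uj] := ih (M `&` [set n | (N <= n)%N]).
- move=> N'; have [n] := uM (maxn N N'); rewrite geq_max => /andP[Nn N'n] Mn.
  by exists n.
- move=> n [Mn /= Nn]; have [j] := MP n Mn.
  rewrite in_cons => /predU1P[->|js Pj]; last by exists j.
  by move/(NP _ Nn Mn).
exists j; first by rewrite in_cons js orbT.
by apply: unboundedS uj => n [[]].
Qed.

End infinite_sets.

(** For one sequence and one tolerance, pigeonhole over a finite net of a disc
    gives a suitable infinite set; the diagonal serves all of them. *)
Lemma diagonal_cauchy {R : realType} (I : countType) (z : I -> nat -> R[i]^o) :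
  (forall i, exists r : R, forall n, rnorm (z i n) <= r) ->
  exists2 M, unbounded M & forall i (e : R), 0 < e ->
    exists N, forall m n, (N <= m)%N -> (N <= n)%N -> M m -> M n ->
      rnorm (z i m - z i n) <= e.
Proof.
move=> zbnd.
pose Q (ik : I * nat) (M : set nat) := exists N, forall m n,
  (N <= m)%N -> (N <= n)%N -> M m -> M n ->
  rnorm (z ik.1 m - z ik.1 n) <= ik.2.+1%:R^-1.
have [|ik M uM|M _ [uM QM]] := @diagonal_extraction _ Q _ _ setT unboundedT.
- move=> ik M M' [N NQ] [N' N'M]; exists (maxn N N') => m n.
  rewrite !geq_max => /andP[Nm N'm] /andP[Nn N'n] Mm Mn.
  by apply: NQ => //; exact: N'M.
- have [r zr] := zbnd ik.1.
  have k0 : 0 < ik.2.+1%:R^-1 / 2 :> R by rewrite divr_gt0.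
  have [s _ net] := disc_tbounded r k0.
  have [|y ys uy] := @unbounded_pigeonhole _ s M
      (fun y n => rdist (z ik.1 n) y <= ik.2.+1%:R^-1 / 2) uM.
    by move=> n _; apply: net; exact: zr.
  exists (M `&` [set n | rdist (z ik.1 n) y <= ik.2.+1%:R^-1 / 2]).
    by move=> n [].
  split=> //; exists 0%N => m n _ _ [_ /= my] [_ /= ny].
  apply: le_trans (ler_rdistD y _ _) _; move: my ny; rewrite /rdist.
  by rewrite (rdistC y); set t := ik.2.+1%:R^-1; lra.
exists M => // i e e0.
have [|k] := @ltr_add_invr R 0 e; first by [].
rewrite add0r => ke; have [N NQ] := QM (i, k); exists N => m n Nm Nn Mm Mn.
by rewrite (le_trans (NQ _ _ Nm Nn Mm Mn))// ltW.
Qed.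

Section operators.
Context {R : realType} {X Y : normedModType R[i]}.

Lemma bop_rnormP (f : bop X Y) x : rnorm (f x) <= rnorm f * rnorm x.
Proof. by rewrite -lecR rmorphM/= -!normE; exact: bop_normP. Qed.

Lemma bop_rnorm_le (f : bop X Y) (C : R) : 0 <= C ->
  (forall x, rnorm x <= 1 -> rnorm (f x) <= C) -> rnorm f <= C.
Proof.
move=> C0 fC; rewrite -lecR -normE; apply: bop_norm_le.
  by rewrite lecR.
by move=> x; rewrite normE -[1]/(1%:C) lecR => /fC; rewrite normE lecR.
Qed.

Definition mk_bop (f : X -> Y) (lf : linear f) (cf : continuous f) : bop X Y :=
  Bop (introT (bop_predP f) (conj lf cf)).

Lemma linear_bop (f : X -> Y) (C : R) : linear f ->
  (forall x, rnorm (f x) <= C * rnorm x) ->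
  exists g : bop X Y, forall x, g x = f x.
Proof.
move=> lf fC; pose F := GRing.isLinear.Build _ _ _ _ f lf.
pose fL : {linear X -> Y} := HB.pack f F.
have cf : continuous fL.
  apply/linear_bounded_rnorm; exists (`|C| + 1).
    by rewrite ltr_wpDl.
  move=> x; rewrite (le_trans (fC x))// ler_wpM2r ?rnorm_ge0//.
  by rewrite (le_trans (ler_norm C))// lerDl.
by exists (mk_bop lf cf).
Qed.

Lemma bop_ucomplete : ucomplete Y -> ucomplete (bop X Y).
Proof.
move=> cY F FF Fc.
have evc x : exists y : Y, (fun f : bop X Y => f x) @ F --> y.
  apply: cY; apply: cauchy_rnorm => e e0.
  have xp : 0 < rnorm x + 1 by rewrite ltr_wpDl// rnorm_ge0.
  have [|B FB Be] := @rnorm_cauchy _ _ _ FF Fc (e / (rnorm x + 1)).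
    by rewrite divr_gt0.
  exists [set f x | f in B].
    by apply: (@filterS _ F _ _ _ _ FB) => f Bf; exists f.
  move=> _ _ [f Bf <-] [g Bg <-].
  rewrite -[f x - g x]/((f - g : bop X Y) x) (le_trans (bop_rnormP _ _))//.
  have := Be _ _ Bf Bg; rewrite ler_pdivlMr//; apply: le_trans.
  by rewrite ler_wpM2l ?rnorm_ge0// lerDl.
have [g gP] := choice evc.
have gF x e : 0 < e -> F [set f : bop X Y | rnorm (g x - f x) <= e].
  by move=> e0; exact: (@cvg_rnorm_near _ _ _ _ _ (gP x) _ e0).
have lg : linear g.
  move=> a x y; apply/eqP; rewrite -subr_eq0; apply/eqP/rnorm_small_eq0 => e e0.
  pose c := rnorm (a : R[i]^o) + 2.
  have c0 : 0 < c by rewrite ltr_wpDl// rnorm_ge0.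
  have d0 : 0 < e / c by rewrite divr_gt0.
  have [f [[fx fy] fxy]] := @filter_ex _ F _ _
    (filterI (filterI (gF x _ d0) (gF y _ d0)) (gF (a *: x + y) _ d0)).
  have -> : g (a *: x + y) - (a *: g x + g y) =
      (g (a *: x + y) - f (a *: x + y)) - (a *: (g x - f x) + (g y - f y)).
    by rewrite (linearP f) scalerBr addrACA -opprD opprB addrA subrK.
  apply: le_trans (ler_rnormB _ _) _; apply: le_trans (lerD fxy (ler_rnormD _ _)) _.
  rewrite rnormZ; apply: (@le_trans _ _ (c * (e / c))); last first.
    by rewrite mulrCA divff ?mulr1// gt_eqF.
  have := ler_wpM2l (rnorm_ge0 (a : R[i]^o)) fx; move: fy => /=.
  by rewrite /c; nra.
have [B FB B1] := rnorm_cauchy FF Fc ltr01; have [b Bb] := filter_ex FB.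
have gC x : rnorm (g x) <= (rnorm b + 1) * rnorm x.
  apply/ler_addgt0Pl => e e0.
  have [f [Bf /= gf]] := @filter_ex _ F _ _ (filterI FB (gF x _ e0)).
  have := lerB_rnorm (g x) (f x); have := bop_rnormP f x.
  have := ler_wpM2r (rnorm_ge0 x) (B1 _ _ Bf Bb); rewrite mul1r.
  have := ler_wpM2r (rnorm_ge0 x) (lerB_rnorm f b).
  rewrite mulrBl mulrDl mul1r; lra.
have [f fg] := linear_bop lg gC.
exists f; apply/cvg_rnormP => e e0.
have [D FD De] := rnorm_cauchy FF Fc e0.
apply: (@filterS _ F _ _ _ _ (FD)) => h Dh; apply: bop_rnorm_le => [|x x1]; first exact: ltW.
apply/ler_addgt0Pl => r r0.
have [k [Dk /= gk]] := @filter_ex _ F _ _ (filterI FD (gF x _ r0)).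
rewrite -[X in rnorm X]/(f x - h x) fg.
apply: le_trans (ler_rdistD (k x) _ _) _; apply: lerD => //.
rewrite -[X in rnorm X]/((k - h : bop X Y) x) (le_trans (bop_rnormP _ _))//.
have := De _ _ Dk Dh; have := rnorm_ge0 (k - h : bop X Y); nra.
Qed.

End operators.

(** * The Hahn-Banach theorem for complex seminorms *)

Section seminorms.
Context {R : realType} {X : lmodType R[i]}.

Record seminorm (p : X -> R) : Prop := Seminorm {
  seminormD : forall x y, p (x + y) <= p x + p y ;
  seminormZ : forall (a : R[i]) x, p (a *: x) = rnorm (a : R[i]^o) * p x }.

Variables (p : X -> R) (pP : seminorm p).

Lemma seminorm0 : p 0 = 0.
Proof. by rewrite -(scale0r 0) (seminormZ pP) rnorm0 mul0r. Qed.

Lemma seminormN x : p (- x) = p x.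
Proof. by rewrite -scaleN1r (seminormZ pP) rnormN rnorm1 mul1r. Qed.

Lemma seminorm_ge0 x : 0 <= p x.
Proof.
have := seminormD pP x (- x); rewrite subrr seminorm0 seminormN.
by rewrite -mulr2n pmulrn_lge0.
Qed.

Lemma seminorm_sub x y : p x <= p y + p (x - y).
Proof. by rewrite (le_trans _ (seminormD pP _ _))// addrC subrK. Qed.

End seminorms.

Section hahn_banach.
Context {R : realType} {X : lmodType R[i]}.
Implicit Types (q : X -> R) (x y : X) (t : R).

Record sublinear q : Prop := Sublinear {
  sublinearD : forall x y, q (x + y) <= q x + q y ;
  sublinearZ : forall t x, 0 <= t -> q (t%:C *: x) <= t * q x }.

Lemma sublinear0 q : sublinear q -> q 0 = 0.
Proof.
move=> qP; apply/eqP; rewrite eq_le; apply/andP; split.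
  by have := sublinearZ qP 0 (lexx 0); rewrite scale0r mul0r.
by have := sublinearD qP 0 0; rewrite addr0; lra.
Qed.

Lemma sublinear_lower q x : sublinear q -> - q (- x) <= q x.
Proof.
move=> qP; have := sublinearD qP x (- x); rewrite subrr sublinear0//; lra.
Qed.

Lemma sublinearZE q t x : sublinear q -> 0 <= t -> q (t%:C *: x) = t * q x.
Proof.
move=> qP t0; apply/eqP; rewrite eq_le (sublinearZ qP)//=.
have [->|tn0] := eqVneq t 0; first by rewrite mul0r scale0r sublinear0.
have ti0 : 0 <= t^-1 by rewrite invr_ge0.
have tp : 0 < t by rewrite lt_neqAle eq_sym tn0.
have := sublinearZ qP (t%:C *: x) ti0.
by rewrite scalerA -rmorphM/= mulVf// scale1r ler_pdivlMl.
Qed.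

Lemma infimum_function (S : X -> set R) (l : X -> R) :
  (forall x, S x !=set0) -> (forall x r, S x r -> l x <= r) ->
  exists f : X -> R, (forall x r, S x r -> f x <= r) /\
    forall x m, (forall r, S x r -> m <= r) -> m <= f x.
Proof.
move=> S0 lS; exists (fun x => inf (S x)); split=> x r.
  by move=> Sr; apply: ge_inf => //; exists (l x) => s /lS.
by move=> Sr; apply: lb_le_inf.
Qed.

(** Sliding q along the ray of y makes it as small as possible at - y while
    keeping it sublinear; a minimal sublinear functional is unchanged by it. *)
Lemma sublinear_slide q y : sublinear q -> exists r, [/\ sublinear r,
  forall x, r x <= q x & forall x t, 0 <= t -> r x <= q (x + t%:C *: y) - t * q y].
Proof.
move=> qP.
pose S x := [set q (x + t%:C *: y) - t * q y | t in [set t | 0 <= t]].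
have [||r [rS Sr]] := @infimum_function S (fun x => - q (- x)).
- by move=> x; exists (q (x + 0%:C *: y) - 0 * q y), 0 => /=.
- move=> x _ [t /= t0 <-]; have := sublinearZE y qP t0.
  have := sublinearD qP (x + t%:C *: y) (- x); rewrite addrAC subrr add0r; lra.
have rq x t : 0 <= t -> r x <= q (x + t%:C *: y) - t * q y.
  by move=> t0; apply: rS; exists t.
exists r; split=> // [|x]; last first.
  by have := rq x 0 (lexx 0); rewrite scale0r addr0 mul0r subr0.
split=> [x1 x2|t x t0].
  rewrite -lerBlDr; apply: (Sr) => _ [t1 /= t10 <-].
  rewrite lerBlDr -lerBlDl; apply: (Sr) => _ [t2 /= t20 <-].
  rewrite lerBlDl (le_trans (rq _ (t1 + t2) _)) ?addr_ge0//.
  have := sublinearD qP (x1 + t1%:C *: y) (x2 + t2%:C *: y).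
  by rewrite addrACA -scalerDl -rmorphD/=; lra.
have [->|tn0] := eqVneq t 0.
  rewrite scale0r mul0r (le_trans (rq 0 0 (lexx 0)))//.
  by rewrite scale0r addr0 mul0r subr0 (sublinear0 qP).
have tp : 0 < t by rewrite lt_neqAle eq_sym tn0.
rewrite -ler_pdivrMl//; apply: (Sr) => _ [s /= s0 <-]; rewrite ler_pdivrMl//.
rewrite (le_trans (rq _ (t * s) _)) ?mulr_ge0//.
have := sublinearZ qP (x + s%:C *: y) t0.
by rewrite scalerDr scalerA -rmorphM/= mulrBr mulrA; lra.
Qed.

(** Zorn's lemma applies because a chain is directed, so that its pointwise
    infimum is again sublinear; it is finite by sublinear_lower. *)
Lemma minimal_sublinear q : sublinear q -> exists m, [/\ sublinear m,
  forall x, m x <= q x &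
  forall r, sublinear r -> (forall x, r x <= m x) -> r = m].
Proof.
move=> qP; pose T := {r : X -> R | sublinear r /\ forall x, r x <= q x}.
pose ge (r s : T) := `[< forall x, sval s x <= sval r x >].
have [|||A Atot|m mmin] := @Zorn T ge.
- by move=> r; apply/asboolP.
- move=> r s u /asboolP rs /asboolP su; apply/asboolP => x.
  exact: le_trans (su x) (rs x).
- move=> [r rP] [s sP] /asboolP/= rs /asboolP/= sr; apply/eq_exist/funext => x.
  by apply/eqP; rewrite eq_le rs sr.
- have [[r0 Ar0]|A0] := pselect (exists r, A r); last first.
    exists (exist _ q (conj qP (fun x => lexx _))) => s As; case: A0.
    by exists s.
  pose S x := [set sval r x | r in A].
  have [||f [fS Sf]] := @infimum_function S (fun x => - q (- x)).
  + by move=> x; exists (sval r0 x), r0.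
  + move=> x _ [[r [rP rq]] _ <-] /=.
    by rewrite (le_trans _ (sublinear_lower x rP))// lerN2.
  have fA x r : A r -> f x <= sval r x by move=> Ar; apply: fS; exists r.
  have fP : sublinear f.
    split=> [x y|t x t0].
      rewrite -lerBlDr; apply: (Sf) => _ [r Ar <-].
      rewrite lerBlDr -lerBlDl; apply: (Sf) => _ [s As <-]; rewrite lerBlDl.
      have [rP _] := svalP r; have [sP _] := svalP s.
      have [/asboolP sr|/asboolP rs] := Atot _ _ Ar As.
        rewrite (le_trans (fA _ _ As))// (le_trans (sublinearD sP _ _))//.
        by rewrite lerD2r.
      rewrite (le_trans (fA _ _ Ar))// (le_trans (sublinearD rP _ _))//.
      by rewrite lerD2l.
    have [->|tn0] := eqVneq t 0.
      have [rP _] := svalP r0.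
      by rewrite scale0r mul0r (le_trans (fA _ _ Ar0))// (sublinear0 rP).
    have tp : 0 < t by rewrite lt_neqAle eq_sym tn0.
    rewrite -ler_pdivrMl//; apply: (Sf) => _ [r Ar <-]; rewrite ler_pdivrMl//.
    have [rP _] := svalP r.
    by rewrite (le_trans (fA _ _ Ar))// (sublinearZ rP).
  have fq x : f x <= q x.
    by have [_ rq] := svalP r0; rewrite (le_trans (fA _ _ Ar0)).
  by exists (exist _ f (conj fP fq)) => s As; apply/asboolP => x; exact: fA.
have [mP mq] := svalP m; exists (sval m); split=> // r rP rm.
have rq x : r x <= q x by rewrite (le_trans (rm x)).
by rewrite -(mmin (exist _ r (conj rP rq)))//; apply/asboolP.
Qed.

(** Minimal sublinear functionals are linear, which replaces the extension of
    functionals from subspaces. Sliding q along y beforehand forces the value at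
    y, since it makes the value at - y equal to - q y. *)
Lemma real_hahn_banach q y : sublinear q -> exists f, [/\
  forall x z, f (x + z) = f x + f z, forall t x, f (t%:C *: x) = t * f x,
  forall x, f x <= q x & f y = q y].
Proof.
move=> qP; have [r [rP rq rslide]] := sublinear_slide y qP.
have [f [fP fr fmin]] := minimal_sublinear rP.
have fD x z : f (x + z) = f x + f z.
  apply/eqP; rewrite eq_le (sublinearD fP)/=.
  have [g [gP gf gslide]] := sublinear_slide z fP.
  have gE := fmin g gP gf; have := gslide x 1 ler01.
  by rewrite gE scale1r mul1r; lra.
have fN x : f (- x) = - f x.
  by have := fD x (- x); rewrite subrr (sublinear0 fP); lra.
have fZ t x : 0 <= t -> f (t%:C *: x) = t * f x.
  move=> t0; apply/eqP; rewrite eq_le (sublinearZ fP)//=.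
  by have := sublinearZ fP (- x) t0; rewrite scalerN !fN; lra.
exists f; split=> //.
- move=> t x; have [t0|t0] := leP 0 t; first exact: fZ.
  by rewrite -[t]opprK rmorphN/= scaleNr fN fZ ?mulNr// oppr_ge0 ltW.
- by move=> x; rewrite (le_trans (fr x)).
apply/eqP; rewrite eq_le (le_trans (fr y) (rq y))/=.
have := rslide (- y) 1 ler01; have := fr (- y).
by rewrite scale1r addNr (sublinear0 qP) mul1r fN; lra.
Qed.

(** A real functional q dominated by p is the real part of the complex functional
    x |-> q x - i q (i x), and rotating a value onto the positive half-line
    bounds its modulus by p. *)
Lemma hahn_banach (p : X -> R) y : seminorm p ->
  exists f : X -> R[i]^o, [/\ linear f, forall x, rnorm (f x) <= p x &
    p y <= rnorm (f y)].
Proof.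
move=> pP; have qP : sublinear p.
  split=> [x z|t x t0]; first exact: seminormD.
  by rewrite (seminormZ pP) rnormC ger0_norm.
have [q [qD qZ qp qy]] := real_hahn_banach y qP.
have qN x : q (- x) = - q x by rewrite -scaleN1r -(rmorphN1 (real_complex R)) qZ mulN1r.
pose f x : R[i]^o := q x +i* (- q ('i%C *: x)).
have fD x z : f (x + z) = f x + f z.
  by apply/eqP; rewrite /f scalerDr !qD opprD eq_complex/= !eqxx.
have fR t x : f (t%:C *: x) = t%:C * f x.
  rewrite /f scalerA mulrC -scalerA !qZ; apply/eqP.
  by rewrite eq_complex/= !mul0r subr0 addr0 mulrN !eqxx.
have fi x : f ('i%C *: x) = 'i%C * f x.
  rewrite /f scalerA -expr2 sqr_i scaleN1r qN opprK; apply/eqP.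
  by rewrite eq_complex/= !mul0r !mul1r !add0r opprK !eqxx.
have fZ (a : R[i]) x : f (a *: x) = a * f x.
  case: a => a b; have -> : a +i* b = a%:C + 'i%C * b%:C.
    by apply/eqP; rewrite eq_complex/= !mul0r !mul1r subr0 ?addr0 ?add0r !eqxx.
  by rewrite scalerDl -scalerA fD fR fi fR mulrDl mulrA.
exists f; split.
- by move=> a x z; rewrite fD fZ.
- move=> x; have [f0|f0] := eqVneq (f x) 0.
    by rewrite f0 rnorm0 seminorm_ge0.
  have fx0 := rnorm_gt0 f0.
  pose u : R[i] := (f x : R[i])^*%R / (rnorm (f x))%:C.
  have u1 : rnorm (u : R[i]^o) = 1.
    rewrite /u -fmorphV (rnormM (_ : R[i]^o)) rnorm_conj rnormC.
    by rewrite ger0_norm ?invr_ge0 ?rnorm_ge0// divff// gt_eqF.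
  have fu : f (u *: x) = (rnorm (f x))%:C.
    rewrite fZ /u mulrAC [_ * f x]mulrC -normCK -[`|_|]/(`|f x : R[i]^o|) normE.
    by rewrite expr2 mulfK// -[0]/(0%:C) (inj_eq (@complexI R)) gt_eqF.
  have -> : rnorm (f x) = q (u *: x) by rewrite -[RHS]/(complex.Re (f (u *: x))) fu.
  by rewrite (le_trans (qp _))// (seminormZ pP) u1 mul1r.
- by rewrite -qy (le_trans _ (rnormC_Re (f y)))//= ler_norm.
Qed.

End hahn_banach.

(** * Null sequences of functionals and precompact balls *)

Lemma cvg_to0_majorant {R : realType} (c : R) (u : nat -> R) : 0 <= c ->
  u @ \oo --> (0 : R) -> forall e, 0 < e -> exists n, c * u n <= e.
Proof.
move=> c0 u0 e e0; have c1 : 0 < c + 1 by rewrite ltr_wpDl.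
move/cvgrPdist_le : u0 => /(_ (e / (c + 1)))[|N _ uN]; first by rewrite divr_gt0.
exists N; have := uN N (leqnn N); rewrite /= sub0r normrN => ue.
rewrite (le_trans (ler_wpM2l c0 (le_trans (ler_norm _) ue)))//.
by rewrite mulrA ler_pdivrMr// mulrC ler_wpM2l ?(ltW e0)// lerDl.
Qed.

Section grothendieck.
Context {R : realType} {V : normedModType R[i]}.
Implicit Types (A : set V) (s : seq V) (e : R).

(** The remainders left by the approximation of A on the net s; they are
    approximated in turn at the next scale. *)
Definition net_errors A s e : set V :=
  [set x | rnorm x <= e /\ exists2 b, b \in s & A (x + b)].

Lemma net_errors_tbounded A s e :
  tbounded rdist A -> tbounded rdist (net_errors A s e).
Proof.
move=> tbA; apply: ultra_tbounded => F FU FA d d0.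
have [|b bs Fb] := @ultra_seq _ _ s (fun b => [set x | A (x + b)]) F FU.
  by apply: (@filterS _ F _ _ _ _ FA) => x [_ [b bs Ab]]; exists b.
have [B FB Bd] := tbounded_ultra rdist_semidistance tbA
  (ultra_fmap (fun x => x + b) FU) Fb d0.
exists [set x | B (x + b)] => // x y Bx By.
by have := Bd _ _ Bx By; rewrite /rdist opprD addrACA subrr addr0.
Qed.

(** Every point of A is the sum of a series of points b_i of F i. The rate 4^-i
    leaves room for the weights 2^(i+1) that turn the series into a convex
    combination of the points 2^(i+1) b_i, which still tend to 0. *)
Lemma tbounded_nets A : tbounded rdist A -> exists (D : nat -> set V) (F : nat -> seq V),
  [/\ D 0%N = A, forall i y, y \in F i -> D i y,
    forall i x, D i.+1 x -> rnorm x <= 4^-1 ^+ i &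
    forall i x, D i x -> exists2 b, b \in F i & D i.+1 (x - b)].
Proof.
move=> tbA.
have step (iD : nat * set V) : exists s : seq V, tbounded rdist iD.2 ->
    (forall y, y \in s -> iD.2 y) /\
    forall x, iD.2 x -> exists2 b, b \in s & rnorm (x - b) <= 4^-1 ^+ iD.1.
  have [tbD|] := pselect (tbounded rdist iD.2); last by exists [::].
  have [|s sD net] := tbD (4^-1 ^+ iD.1); first by rewrite exprn_gt0// invr_gt0.
  by exists s.
have [f fP] := choice step.
pose D := fix D i := if i is k.+1 then net_errors (D k) (f (k, D k)) (4^-1 ^+ k)
  else A.
have tbD i : tbounded rdist (D i).
  by elim: i => [//|i ih]; exact: net_errors_tbounded.
exists D, (fun i => f (i, D i)); split=> // [i y|i x []//|i x Dx].
  by have [sD _] := fP (i, D i) (tbD i); exact: sD.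
have [_ net] := fP (i, D i) (tbD i); have [b bs xb] := net x Dx.
by exists b => //; split=> //; exists b => //; rewrite subrK.
Qed.

(** Grothendieck: a totally bounded set lies in the closed convex hull of a null
    sequence. The hull is expressed by the seminorms q, each of which is bounded
    on the set by any bound that it has on the sequence. *)
Lemma null_sequence_hull A : tbounded rdist A ->
  exists2 v : nat -> V, v @ \oo --> (0 : V) &
    forall (q : V -> R) (C M : R), seminorm q -> 0 <= M ->
      (forall x, q x <= C * rnorm x) -> (forall n, q (v n) <= M) ->
      forall x, A x -> q x <= M.
Proof.
move=> tbA; have [D [F [D0 FD Dnorm net]]] := tbounded_nets tbA.
pose w (ij : nat * nat) : V := (2 ^+ ij.1.+1)%:C *: nth 0 (F ij.1) ij.2.
pose v n := if @pickle_inv (nat * nat)%type n is Some ij then w ij else 0.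
have vw ij : v (pickle ij) = w ij by rewrite /v pickleK_inv.
exists v.
  apply/cvgn_rnormP => e e0.
  (* a point of F (i + 1) has norm at most 4^-i, so its multiple in v is bounded
     by 2^(i + 2) 4^-i = 4 / 2^i *)
  have [||I Ie] := @cvg_to0_majorant R 4 (fun i => 2^-1 ^+ i) _ _ e e0.
  - by [].
  - by apply: cvg_expr; rewrite ger0_norm// invf_lt1// ltr1n.
  exists (\max_(i < I.+1) \max_(j < size (F i)) (pickle (i : nat, j : nat)).+1) => n nN.
  rewrite sub0r rnormN; have := @pickle_invK (nat * nat)%type n.
  rewrite /v; case: pickle_inv => [[i j]/= ijn|_]; last by rewrite rnorm0 ltW.
  rewrite /w /= rnormZr ?exprn_ge0//.
  have [js|js] := ltnP j (size (F i)); last by rewrite nth_default// rnorm0 mulr0 ltW.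
  have [iI|] := ltnP i I.+1.
    exfalso; have := leq_trans (leq_bigmax (Ordinal iI)) nN.
    move=> /(leq_trans (leq_bigmax (Ordinal js))).
    by rewrite /= ijn ltnn.
  case: i js ijn => [//|i js _ Ii].
  have /Dnorm := FD i.+1 _ (mem_nth 0 js).
  have p0 : 0 <= 2 ^+ i.+2 :> R by rewrite exprn_ge0.
  move=> /(ler_wpM2l p0)/le_trans; apply; apply: le_trans Ie.
  have -> : 4^-1 = 2^-1 * 2^-1 :> R by rewrite -invfM -natrM.
  rewrite !exprS exprMn !mulrA -(mulrA (2 * 2)) -exprMn divff// expr1n mulr1.
  by rewrite -natrM ler_wpM2l// ler_wiXn2l ?invr_ge0 ?invf_le1// ?ler1n//.
move=> q C M qP M0 qC qM.
have qF i b : b \in F i -> q b <= 2^-1 ^+ i.+1 * M.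
  move=> /(nthP 0)[j js <-]; have := qM (pickle (i, j)).
  rewrite vw /w (seminormZ qP) rnormC ger0_norm ?exprn_ge0//=.
  by rewrite mulrC -ler_pdivlMr ?exprn_gt0// exprVn mulrC.
have C0 : 0 <= `|C| by [].
have qC' x : q x <= `|C| * rnorm x.
  by rewrite (le_trans (qC x))// ler_wpM2r ?rnorm_ge0// ler_norm.
have key N i x : D i x -> q x <= 2^-1 ^+ i * M + `|C| * 4^-1 ^+ (i + N).
  elim: N i x => [|N ih] i x Dx.
  - have [b bF xb] := net i x Dx; have := qF _ _ bF.
    have := seminorm_sub qP x b; have := qC' (x - b).
    have := ler_wpM2l C0 (Dnorm _ _ xb); rewrite addn0 exprS.
    have : 0 <= 2^-1 ^+ i * M by rewrite mulr_ge0// exprn_ge0.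
    lra.
  - have [b bF xbD] := net i x Dx; have := qF _ _ bF.
    have := seminorm_sub qP x b; have := ih _ _ xbD; rewrite addSnnS exprS.
    lra.
move=> x Ax; apply/ler_addgt0Pl => e e0.
have [|N Ne] := @cvg_to0_majorant R `|C| (fun i => 4^-1 ^+ i) C0 _ e e0.
  by apply: cvg_expr; rewrite ger0_norm// invf_lt1// ltr1n.
have := key N 0%N x; rewrite D0 => /(_ Ax); rewrite expr0 mul1r add0n; lra.
Qed.

End grothendieck.

Section precompact_balls.
Context {R : realType} {X : normedModType R[i]}.
Local Notation C := (R[i]^o).

(** Equicontinuity arguments test finitely many points at a time; along an
    ultrafilter they can be tested separately. *)
Lemma tbounded_ultra_finite (I : finType) (T : eqType) (d : I -> T -> T -> R)
    (A : set T) (F : set_system T) :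
  (forall i, semidistance (d i)) -> (forall i, tbounded (d i) A) ->
  UltraFilter F -> F A -> forall e : R, 0 < e ->
  exists2 B, F B & forall i x y, B x -> B y -> d i x y <= e.
Proof.
move=> dP tbA FU FA e e0.
have step i : exists B, F B /\ forall x y, B x -> B y -> d i x y <= e.
  by have [B FB Be] := tbounded_ultra (dP i) (tbA i) FU FA e0; exists B.
have [B BP] := choice step.
exists [set x | forall i, B i x].
  by apply: filter_forall => i; case: (BP i).
by move=> i x y Bx By; case: (BP i) => _; apply.
Qed.

Lemma eval_semidistance (T : eqType) (V : normedModType R[i]) (f : T -> V) :
  semidistance (fun x y => rnorm (f x - f y)).
Proof.
have [d0 dC dD] := @rdist_semidistance R V.
by split=> [x|x y|z x y]; [exact: d0|exact: dC|exact: dD].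
Qed.

Lemma eval_tbounded (T : eqType) (f : T -> C) (r : R) (A : set T) :
  (forall x, A x -> rnorm (f x) <= r) ->
  tbounded (fun x y => rnorm (f x - f y)) A.
Proof.
move=> fr; apply: ultra_tbounded => F FU FA e e0.
have Ff : fmap f F [set z | rnorm z <= r].
  by apply: (@filterS _ F _ _ _ _ FA) => x /fr.
have [B FB Be] := tbounded_ultra rdist_semidistance (disc_tbounded r)
  (ultra_fmap f FU) Ff e0.
by exists (f @^-1` B) => // x y Bx By; exact: Be.
Qed.

Lemma rnorm_seminorm : seminorm (@rnorm R X).
Proof. by split=> [x y|a x]; [exact: ler_rnormD|exact: rnormZ]. Qed.

Variables (p : X -> R) (pP : seminorm p).

(** The Hahn-Banach theorem; a bound on p by the norm makes the functional
    continuous. *)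
Lemma dominated_functional (D : R) x : (forall z, p z <= D * rnorm z) ->
  exists f : bop X C, (forall z, rnorm (f z) <= p z) /\ p x <= rnorm (f x).
Proof.
move=> pD; have [f [lf fp pf]] := hahn_banach x pP.
have [g gf] : exists g : bop X C, forall z, g z = f z.
  by apply: (@linear_bop _ _ _ _ D) => // z; rewrite (le_trans (fp z)).
by exists g; split=> [z|]; rewrite gf.
Qed.

(** Arzela-Ascoli in the dual: functionals dominated by p are equicontinuous on
    the p-totally bounded ball. *)
Lemma dominated_functionals_tbounded (D : R) :
  (forall x, p x <= D * rnorm x) ->
  tbounded (fun x y => p (x - y)) (@unit_ball R X) ->
  tbounded rdist [set f : bop X C | forall x, rnorm (f x) <= p x].
Proof.
move=> pD tbB; apply: ultra_tbounded => F FU FA e e0.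
have e30 : 0 < e / 3 by rewrite divr_gt0.
have [s sB net] := tbB _ e30.
have [i|i|B FB Be] := @tbounded_ultra_finite 'I_(size s) (bop X C)
    (fun i f g => rnorm (f (nth 0 s i) - g (nth 0 s i)))
    [set f : bop X C | forall x, rnorm (f x) <= p x] F _ _ FU FA (e / 3) e30.
- exact: (eval_semidistance (fun f : bop X C => f (nth 0 s i))).
- apply: (@eval_tbounded _ (fun f : bop X C => f (nth 0 s i)) (p (nth 0 s i))).
  by move=> f /=.
exists (B `&` [set f : bop X C | forall x, rnorm (f x) <= p x]).
  exact: filterI.
move=> f g [Bf fp] [Bg gp]; apply: bop_rnorm_le => [|x x1]; first exact: ltW.
have /net[y ys xy] : unit_ball x by apply/unit_ballE.
have ys' : (index y s < size s)%N by rewrite index_mem.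
have := Be (Ordinal ys') _ _ Bf Bg; rewrite /= nth_index// => fgy.
rewrite -[X in rnorm X]/(f x - g x).
have -> : f x - g x = (f y - g y) + (f (x - y) - g (x - y)).
  by rewrite (linearB f) (linearB g) opprB addrACA (addrC (f y)) subrK addKr.
have := ler_rnormD (f y - g y) (f (x - y) - g (x - y)).
have := ler_rnormB (f (x - y)) (g (x - y)).
have := fp (x - y); have := gp (x - y); lra.
Qed.

(** The seminorm p is the supremum of the moduli of the functionals that it
    dominates, and these lie in the hull of a null sequence. *)
Lemma precompact_ball_majorant (D : R) :
  (forall x, p x <= D * rnorm x) ->
  tbounded (fun x y => p (x - y)) (@unit_ball R X) ->
  exists2 x' : nat -> bop X C, x' @ \oo --> (0 : bop X C) &
    forall x M, 0 <= M -> (forall n, rnorm (x' n x) <= M) -> p x <= M.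
Proof.
move=> pD tbB.
have [x' x'0 hull] := null_sequence_hull (dominated_functionals_tbounded pD tbB).
exists x' => // x M M0 x'M; have [f [fp pf]] := dominated_functional x pD.
apply: le_trans pf _.
apply: (hull (fun h : bop X C => rnorm (h x)) (rnorm x) M) => //.
- split=> [h k|a h]; first exact: ler_rnormD.
  by rewrite -[(a *: h) x]/(a *: h x) rnormZ.
- by move=> h; rewrite mulrC; exact: bop_rnormP.
Qed.

(** Up to a small error only finitely many functionals of the null sequence
    matter on the ball, and each of them has a bounded image in the plane. *)
Lemma majorant_precompact_ball (x' : nat -> bop X C) :
  x' @ \oo --> (0 : bop X C) ->
  (forall x M, 0 <= M -> (forall n, rnorm (x' n x) <= M) -> p x <= M) ->
  (exists2 D : R, 0 <= D & forall x, p x <= D * rnorm x) /\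
  tbounded (fun x y => p (x - y)) (@unit_ball R X).
Proof.
move=> /cvgn_rnormP x'0 px'.
have x'e e : 0 < e -> exists N, forall n, (N <= n)%N -> rnorm (x' n) <= e.
  move=> /x'0[N x'N]; exists N => n /x'N.
  by rewrite sub0r rnormN.
split.
  have [N x'N] := x'e 1 ltr01; have [D D0 x'D] := eventually_bounded x'N.
  exists D => // x; apply: px'; first by rewrite mulr_ge0// rnorm_ge0.
  by move=> n; rewrite (le_trans (bop_rnormP _ _))// ler_wpM2r ?rnorm_ge0.
apply: ultra_tbounded => F FU FA e e0.
have e20 : 0 < e / 2 by rewrite divr_gt0.
have [N x'N] := x'e _ e20.
have [i|i|B FB Be] := @tbounded_ultra_finite 'I_N X
    (fun i x y => rnorm (x' i x - x' i y)) (@unit_ball R X) F _ _ FU FA e e0.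
- exact: (eval_semidistance (x' i)).
- apply: (@eval_tbounded _ (x' i) (rnorm (x' i))) => x /unit_ballE x1.
  by rewrite (le_trans (bop_rnormP _ _))// ler_piMr// rnorm_ge0.
exists (B `&` @unit_ball R X); first exact: filterI.
move=> x y [Bx /unit_ballE x1] [By /unit_ballE y1].
apply: px' => [|n]; first exact: ltW.
have [nN|/x'N x'n] := ltnP n N.
  by rewrite linearB; exact: (Be (Ordinal nN)).
rewrite (le_trans (bop_rnormP _ _))//.
have := ler_rnormB x y; have := rnorm_ge0 (x - y); have := rnorm_ge0 (x' n); nra.
Qed.

End precompact_balls.

(** * Independent sequences of pairs of sets *)

Section independence.
Context {T : Type} (A B : nat -> set T).
Implicit Types (M : set nat) (D : set T).

Definition oscillates M (f : T) :=
  unbounded (M `&` [set n | A n f]) /\ unbounded (M `&` [set n | B n f]).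

(** Oscillation is required along all infinite subsets of M, so that it survives
    the repeated passage to subsets. *)
Definition oscillating M D := forall M', M' `<=` M -> unbounded M' ->
  exists2 f, D f & oscillates M' f.

Definition almost_sub M' M := exists N, forall n, (N <= n)%N -> M' n -> M n.

Lemma oscillatesS M' M f : almost_sub M' M -> oscillates M' f -> oscillates M f.
Proof.
have unb (P : set nat) N : (forall n, (N <= n)%N -> M' n -> M n) ->
    unbounded (M' `&` P) -> unbounded (M `&` P).
  move=> NM uMP k; have [n] := uMP (maxn N k).
  rewrite geq_max => /andP[Nn kn] [M'n Pn]; exists n => //.
  by split=> //; exact: NM.
by move=> [N NM] [uA uB]; split; apply: (unb _ N NM).
Qed.

Definition side (b : bool) n := if b then A n else B n.

(** If no index n served, each would be spoiled by some D in the list and one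
    side of the pair; pigeonhole makes the culprit the same along an infinite
    set of indices, along which D then contains no oscillating point. *)
Lemma oscillating_split (s : seq (set T)) M N : unbounded M ->
  (forall D, D \in s -> oscillating M D) ->
  exists n M', [/\ (N <= n)%N, M' `<=` M, unbounded M' &
    forall D b, D \in s -> oscillating M' (D `&` side b n)].
Proof.
move=> uM osM; apply: contrapT => nosplit.
have step (kM : nat * set nat) : exists r : nat * set nat * (set T * bool),
    unbounded kM.2 -> kM.2 `<=` M ->
    [/\ (kM.1 <= r.1.1)%N, kM.2 r.1.1, r.1.2 `<=` kM.2, unbounded r.1.2 &
      [/\ r.2.1 \in s &
      forall f, r.2.1 f -> side r.2.2 r.1.1 f -> ~ oscillates r.1.2 f]].
  case: kM => k M' /=; have [[uM' M'M]|nM'] := pselect (unbounded M' /\ M' `<=` M);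
    last by exists (0%N, setT, (setT, true)) => uM' M'M; case: nM'.
  have [n] := uM' (maxn k N); rewrite geq_max => /andP[kn Nn] M'n.
  apply: contrapT => nr; apply: nosplit; exists n, M'; split=> // D b Ds.
  move=> M'' M''M' uM''; apply: contrapT => nf; apply: nr.
  exists (n, M'', (D, b)) => _ _; split=> //; split=> // f Df bf oM''.
  by apply: nf; exists f.
have [g gP] := choice step.
pose st := fix st k :=
  if k is l.+1 then g ((st l).1.1.+1, (st l).1.2) else g (0%N, M).
have inv k : unbounded (st k).1.2 /\ (st k).1.2 `<=` M.
  elim: k => [|k [uk kM]] /=; first by have [] := gP (0%N, M) uM (@subset_refl _ M).
  have [_ _ sub u _] := gP ((st k).1.1.+1, (st k).1.2) uk kM.
  by split=> //; exact: subset_trans kM.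
have stS k : [/\ ((st k).1.1 < (st k.+1).1.1)%N, (st k).1.2 (st k.+1).1.1 &
    (st k.+1).1.2 `<=` (st k).1.2].
  by have [uk kM] := inv k; have [] := gP ((st k).1.1.+1, (st k).1.2) uk kM.
have stM k : M (st k).1.1.
  case: k => [|k]; first by have [] := gP (0%N, M) uM (@subset_refl _ M).
  by have [_ + _] := stS k; apply: (inv k).2.
have bad k : (st k).2.1 \in s /\
    forall f, (st k).2.1 f -> side (st k).2.2 (st k).1.1 f ->
      ~ oscillates (st k).1.2 f.
  case: k => [|k]; first by have [_ _ _ _ []] := gP (0%N, M) uM (@subset_refl _ M).
  have [uk kM] := inv k.
  by have [_ _ _ _ []] := gP ((st k).1.1.+1, (st k).1.2) uk kM.
have decr k l : (k <= l)%N -> (st l).1.2 `<=` (st k).1.2.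
  elim: l => [|l ih]; first by rewrite leqn0 => /eqP ->.
  rewrite leq_eqVlt => /predU1P[->//|/ih]; apply: subset_trans.
  by have [] := stS l.
have incr : forall k, ((st k).1.1 < (st k.+1).1.1)%N by move=> k; case: (stS k).
have later k l : (k < l)%N -> (st k).1.2 (st l).1.1.
  case: l => // l; rewrite ltnS => /decr; apply.
  by have [] := stS l.
have [|[D b] _ uL] := @unbounded_pigeonhole _ [seq (D, b) | D <- s, b <- [:: true; false]]
    setT (fun l k => (st k).2 = l) unboundedT.
  move=> k _; exists (st k).2 => //; have [stk _] := bad k.
  rewrite [(st k).2]surjective_pairing; apply: allpairs_f => //.
  by case: (st k).2.2.
(* D oscillates along L, so one of its points lies on the side b of some index
   in L, but that index was chosen to prevent oscillation on almost all of L *)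
pose L := [set (st k).1.1 | k in [set k | (st k).2 = (D, b)]].
have uLM : unbounded L.
  move=> k; have [l kl [_ ll]] := uL k; exists (st l).1.1; last by exists l.
  exact: leq_trans kl (incr_geq incr l).
have Ds : D \in s.
  by have [k _ [_ kD]] := uL 0%N; have [] := bad k; rewrite kD.
have [|f Df [uA uB]] := osM D Ds L _ uLM; first by move=> _ [k _ <-].
have [n Ln nf] : exists2 n, L n & side b n f.
  case: (b); first by have [n _ [Ln An]] := uA 0%N; exists n.
  by have [n _ [Ln Bn]] := uB 0%N; exists n.
case: Ln nf => k /= kDb <- nf; have [_ /(_ f)] := bad k; rewrite kDb /= => /(_ Df nf).
apply; apply: (@oscillatesS L) => //; exists (st k).1.1.+1 => m km [l _ lm].
rewrite -lm; apply: later; rewrite ltnNge; apply/negP => lk.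
move: km; rewrite -lm ltnNge => /negP; apply.
move: lk; rewrite leq_eqVlt => /predU1P[->//|lk]; exact: ltnW (incr_ltn incr lk).
Qed.

(** Iterating the splitting keeps all the cells of the generated partition
    oscillating, in particular nonempty. *)
Lemma independent_subsequence M D : unbounded M -> oscillating M D ->
  exists2 e : nat -> nat, forall k, (e k < e k.+1)%N &
    forall (sigma : nat -> bool) k, exists2 f, D f &
      forall i, (i < k)%N -> side (sigma i) (e i) f.
Proof.
move=> uM oM.
have step (st : nat * set nat * seq (set T)) : exists r : nat * set nat,
    unbounded st.1.2 -> (forall E, E \in st.2 -> oscillating st.1.2 E) ->
    [/\ (st.1.1 <= r.1)%N, unbounded r.2 &
      forall E b, E \in st.2 -> oscillating r.2 (E `&` side b r.1)].
  case: st => -[N M'] s /=.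
  have [[uM' oM']|nM'] := pselect (unbounded M' /\
      forall E, E \in s -> oscillating M' E); last first.
    by exists (0%N, setT) => uM' oM'; case: nM'.
  have [n [M'' [Nn _ uM'' split]]] := oscillating_split N uM' oM'.
  by exists (n, M'').
have [g gP] := choice step.
pose next (st : nat * set nat * seq (set T)) :=
  ((g st).1.+1, (g st).2, [seq E `&` side b (g st).1 | E <- st.2, b <- [:: true; false]]).
pose st k := iter k next (0%N, M, [:: D]).
have inv k : unbounded (st k).1.2 /\
    forall E, E \in (st k).2 -> oscillating (st k).1.2 E.
  elim: k => [|k [uk ok]]; first by split=> // E; rewrite mem_seq1 => /eqP ->.
  have [_ u split] := gP (st k) uk ok.
  rewrite -[st k.+1]/(next (st k)); split=> // E.
  by move=> /allpairsP[[E' b] [/= E's _ ->]]; exact: split.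
pose e k := (g (st k)).1.
have eS k : (e k < e k.+1)%N.
  by have [uk ok] := inv k.+1; have [] := gP (st k.+1) uk ok.
exists e => // sigma k.
have [E Es EP] : exists2 E, E \in (st k).2 &
    forall f, E f -> D f /\ forall i, (i < k)%N -> side (sigma i) (e i) f.
  elim: k => [|k [E Es EP]]; first by exists D => //=; rewrite mem_seq1.
  exists (E `&` side (sigma k) (e k)).
    by apply: allpairs_f => //; case: (sigma k).
  move=> f [/EP[Df sf] kf]; split=> // i.
  by rewrite ltnS leq_eqVlt => /predU1P[->|/sf].
have [uk /(_ _ Es)] := inv k.
by move=> /(_ _ (@subset_refl _ _) uk)[f /EP[Df sf] _]; exists f.
Qed.

End independence.

(** * Rosenthal's theorem on the space of summable sequences *)

Section rosenthal.
Context {R : realType}.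
Local Notation C := (R[i]^o).

(** Either the real or the imaginary parts carry half of the sum of the moduli,
    and signs align them. *)
Lemma complex_signs (c : nat -> C) n : exists sigma : nat -> bool,
  \sum_(0 <= k < n) rnorm (c k) <=
    2 * rnorm (\sum_(0 <= k < n) (if sigma k then c k else - c k)).
Proof.
have align (p : C -> R) : {morph p : x y / x + y} -> {morph p : x / - x} ->
    p 0 = 0 -> (forall z, `|p z| <= rnorm z) ->
    \sum_(0 <= k < n) `|p (c k)| <=
      rnorm (\sum_(0 <= k < n) (if 0 <= p (c k) then c k else - c k)).
  move=> pD pN p0 pz; apply: le_trans (pz _); apply: le_trans (ler_norm _).
  rewrite (big_morph p pD p0) le_eqVlt; apply/orP; left; apply/eqP.
  apply: eq_bigr => k _; case: ifPn => [/ger0_norm->//|].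
  by rewrite -ltNge pN => /ltr0_norm->.
have reD : {morph (@complex.Re R : C -> R) : x y / x + y} by case=> ? ? [].
have reN : {morph (@complex.Re R : C -> R) : x / - x} by case.
have imD : {morph (@complex.Im R : C -> R) : x y / x + y} by case=> ? ? [].
have imN : {morph (@complex.Im R : C -> R) : x / - x} by case.
have := align _ reD reN erefl rnormC_Re.
have := align _ imD imN erefl rnormC_Im.
have : \sum_(0 <= k < n) rnorm (c k) <=
    \sum_(0 <= k < n) `|complex.Re (c k)| + \sum_(0 <= k < n) `|complex.Im (c k)|.
  rewrite -big_split/=; apply: ler_sum => k _; case: (c k) => a b.
  exact: rnormCE.
set re := \sum_(0 <= k < n) `|complex.Re _|.
set im := \sum_(0 <= k < n) `|complex.Im _|.
have [re_im|im_re] := leP re im => cri imle rele.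
  by exists (fun k => 0 <= complex.Im (c k)); lra.
by exists (fun k => 0 <= complex.Re (c k)); lra.
Qed.

Context {X : normedModType R[i]}.

(** Dor's argument: two functionals with opposite patterns differ by plus or
    minus a - b at every y k, up to the small radius of the discs. *)
Lemma independent_lower_bound (y : nat -> X) (a b : C) (rho : R) :
  8 * rho <= rnorm (a - b) ->
  (forall (sigma : nat -> bool) n, exists2 f : bop X C,
    forall x, rnorm (f x) <= rnorm x & forall k, (k < n)%N ->
      rnorm (f (y k) - (if sigma k then a else b)) <= rho) ->
  forall (c : nat -> C) n, rnorm (a - b) / 8 * \sum_(0 <= k < n) rnorm (c k) <=
    rnorm (\sum_(0 <= k < n) (c k : R[i]) *: y k).
Proof.
move=> rhoab pattern c n.
have [sigma csigma] := complex_signs c n.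
have [f f1 fP] := pattern sigma n.
have [g g1 gP] := pattern (fun k => ~~ sigma k) n.
set v := \sum_(0 <= k < n) _ *: _.
set t := \sum_(0 <= k < n) (if _ then _ else _) in csigma.
set s := \sum_(0 <= k < n) rnorm _ in csigma *.
(* the functional f - g takes the value +-(a - b) + eta k at y k *)
pose eta k : C := f (y k) - g (y k) - (if sigma k then a - b else - (a - b)).
have eta_le k : (k < n)%N -> rnorm (eta k) <= 2 * rho.
  move=> kn; have := fP k kn; have := gP k kn; rewrite /eta.
  case: (sigma k) => /= gk fk.
    have -> : f (y k) - g (y k) - (a - b) = (f (y k) - a) - (g (y k) - b).
      by rewrite opprB opprD !addrA; ring.
    by have := ler_rnormB (f (y k) - a) (g (y k) - b); lra.
  have -> : f (y k) - g (y k) - - (a - b) = (f (y k) - b) - (g (y k) - a).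
    by ring.
  by have := ler_rnormB (f (y k) - b) (g (y k) - a); lra.
have vE : (a - b) * t = (f v - g v) - \sum_(0 <= k < n) c k * eta k.
  rewrite /v /t (linear_sum f) (linear_sum g) -!sumrB mulr_sumr; apply: eq_bigr => k _.
  rewrite (linearZ_LR f) (linearZ_LR g)/= /eta -[c k *: f (y k)]/(c k * f (y k)).
  rewrite -[c k *: g (y k)]/(c k * g (y k)).
  by case: (sigma k); ring.
have s0 : 0 <= s by rewrite sumr_ge0// => k _; exact: rnorm_ge0.
have eta_sum : rnorm (\sum_(0 <= k < n) c k * eta k) <= 2 * rho * s.
  apply: le_trans (rnorm_sum _ _ _) _; rewrite mulr_sumr.
  rewrite big_nat_cond [leRHS]big_nat_cond; apply: ler_sum => k.
  rewrite andbT => /andP[_ kn]; rewrite rnormM mulrC.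
  by rewrite ler_wpM2r ?rnorm_ge0// eta_le.
have := ler_rnormB (f v - g v) (\sum_(0 <= k < n) c k * eta k).
rewrite -vE rnormM; have := ler_rnormB (f v) (g v).
have := f1 v; have := g1 v; have := rnorm_ge0 (a - b).
have := ler_wpM2r s0 rhoab; have := ler_wpM2l (rnorm_ge0 (a - b)) csigma.
lra.
Qed.

Lemma ell1_sum (a : nat -> C) : ell1 a -> exists r : R, [/\
  ell1_norm a = r%:E, forall n, \sum_(0 <= k < n) rnorm (a k) <= r &
  forall e, 0 < e -> exists N, r - e <= \sum_(0 <= k < N) rnorm (a k)].
Proof.
move=> la; have ge0 k : (0 <= (rnorm (a k))%:E)%E by rewrite lee_fin rnorm_ge0.
have fin : ell1_norm a \is a fin_num.
  by rewrite ge0_fin_numE//; apply: nneseries_ge0 => k _ _.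
exists (fine (ell1_norm a)); rewrite fineK//; split=> // [n|e e0].
  rewrite -lee_fin fineK// -sumEFin; apply: nneseries_lim_ge => k _ _.
  exact: ge0.
apply: contrapT => /forallNP small.
suff : (ell1_norm a <= (fine (ell1_norm a) - e)%:E)%E.
  by rewrite -[X in (X <= _)%E]fineK// lee_fin; lra.
apply: lime_le; first by apply: is_cvg_nneseries => k _ _; exact: ge0.
apply: nearW => n; rewrite sumEFin lee_fin.
by have /negP := small n; rewrite -ltNge => /ltW.
Qed.

(** The embedding sends a summable sequence c to the sum of the series of the
    vectors c k y k; the lower bound on finite sums passes to the limit. *)
Lemma lower_bound_ell1 (y : nat -> X) (d : R) : ucomplete X -> 0 < d ->
  (forall n, rnorm (y n) <= 1) ->
  (forall (c : nat -> C) n, d * \sum_(0 <= k < n) rnorm (c k) <=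
    rnorm (\sum_(0 <= k < n) (c k : R[i]) *: y k)) ->
  contains_ell1 X.
Proof.
move=> cX d0 y1 ylow.
pose S (a : nat -> C) n := \sum_(0 <= k < n) (a k : R[i]) *: y k.
have S_up a n : rnorm (S a n) <= \sum_(0 <= k < n) rnorm (a k).
  apply: le_trans (rnorm_sum _ _ _) _; apply: ler_sum => k _.
  by rewrite rnormZ ler_piMr// rnorm_ge0.
have Scvg a : ell1 a -> exists l : X, S a @ \oo --> l.
  move=> /ell1_sum[r [_ ar ra]]; apply: cX; apply: cauchy_rnorm => e e0.
  have e20 : 0 < e / 2 by rewrite divr_gt0.
  have [N rN] := ra _ e20.
  have tail n : (N <= n)%N -> rnorm (S a n - S a N) <= e / 2.
    move=> Nn; rewrite /S (big_cat_nat (n := N))//= addrAC subrr add0r.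
    have := ar n; rewrite (big_cat_nat (n := N))//= => arn.
    apply: (@le_trans _ _ (\sum_(N <= k < n) rnorm (a k))); last by lra.
    apply: le_trans (rnorm_sum _ _ _) _; apply: ler_sum => k _.
    by rewrite rnormZ ler_piMr// rnorm_ge0.
  exists [set S a n | n in [set n | (N <= n)%N]]; first by exists N => // n /= Nn; exists n.
  move=> _ _ [m /= Nm <-] [n /= Nn <-].
  apply: le_trans (ler_rdistD (S a N) _ _) _.
  by have := tail _ Nm; have := tail _ Nn; rewrite (rdistC (S a N)); lra.
pose T a : X := xget 0 [set l | S a @ \oo --> l].
have TP a : ell1 a -> S a @ \oo --> T a.
  by move=> /Scvg[l Sl]; apply: (@xgetPex _ 0 [set l | S a @ \oo --> l]); exists l.
have Tapprox a (e : R) : ell1 a -> 0 < e -> exists N, forall n, (N <= n)%N ->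
    rnorm (T a - S a n) <= e.
  by move=> /TP/cvgn_rnormP Ta /Ta.
have ell1D (c : R[i]) (a b : nat -> C) : ell1 a -> ell1 b -> ell1 (c *: a + b).
  move=> /ell1_sum[r [_ ar _]] /ell1_sum[s [_ bs _]].
  apply: (@le_lt_trans _ _ (rnorm (c : C) * r + s)%:E); last exact: ltry.
  apply: lime_le.
    by apply: is_cvg_nneseries => k _ _; rewrite lee_fin rnorm_ge0.
  apply: nearW => n; rewrite sumEFin lee_fin.
  apply: (@le_trans _ _ (\sum_(0 <= k < n) (rnorm (c : C) * rnorm (a k) + rnorm (b k)))).
    apply: ler_sum => k _; rewrite -[(c *: a + b) k]/(c * a k + b k).
    by rewrite -rnormM ler_rnormD.
  rewrite big_split/= -mulr_sumr lerD// ler_wpM2l// rnorm_ge0//.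
exists T; split.
  move=> c a b la lb; apply/eqP; rewrite -subr_eq0.
  apply/eqP/rnorm_small_eq0 => e e0.
  pose q := rnorm (c : C) + 2.
  have q0 : 0 < q by rewrite ltr_wpDl// rnorm_ge0.
  have eq0 : 0 < e / q by rewrite divr_gt0.
  have [Na aN] := Tapprox a _ la eq0; have [Nb bN] := Tapprox b _ lb eq0.
  have [Nc cN] := Tapprox (c *: a + b) _ (ell1D c a b la lb) eq0.
  pose n := maxn (maxn Na Nb) Nc.
  have /aN an : (Na <= n)%N by rewrite !leq_max leqnn.
  have /bN bn : (Nb <= n)%N by rewrite !leq_max leqnn orbT.
  have /cN cn : (Nc <= n)%N by rewrite leq_max leqnn orbT.
  have SD : S (c *: a + b) n = c *: S a n + S b n.
    rewrite /S scaler_sumr -big_split/=; apply: eq_bigr => k _.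
    by rewrite scalerA -scalerDl.
  have -> : T (c *: a + b) - (c *: T a + T b) =
      (T (c *: a + b) - S (c *: a + b) n) -
      (c *: (T a - S a n) + (T b - S b n)).
    by rewrite SD scalerBr addrACA -opprD opprB addrA subrK.
  apply: le_trans (ler_rnormB _ _) _; apply: le_trans (lerD cn (ler_rnormD _ _)) _.
  rewrite rnormZ; apply: (@le_trans _ _ (q * (e / q))); last first.
    by rewrite mulrCA divff ?mulr1// gt_eqF.
  by have := ler_wpM2l (rnorm_ge0 (c : C)) an; rewrite /q; lra.
exists d, 1; split=> // a la; have [r [-> ar ra]] := ell1_sum la.
rewrite -!EFinM !lee_fin mul1r; apply/andP; split.
  apply/ler_addgt0Pl => e e0; pose t := e / (d + 1).
  have t0 : 0 < t by rewrite divr_gt0// addr_gt0.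
  have [N rN] := ra _ t0; have [N' TN'] := Tapprox _ _ la t0.
  have : r - t <= \sum_(0 <= k < maxn N N') rnorm (a k).
    rewrite (le_trans rN)// [leRHS](big_cat_nat (n := N))//= ?leq_maxl// lerDl sumr_ge0//.
    by move=> k _; exact: rnorm_ge0.
  have := TN' _ (leq_maxr N N'); have := ylow a (maxn N N').
  have := lerB_rnorm (S a (maxn N N')) (T a); rewrite rdistC.
  have -> : e = t * (d + 1) by rewrite /t divfK// gt_eqF// addr_gt0.
  rewrite -/(S a (maxn N N')) => h1 h2 h3 /(ler_wpM2l (ltW d0)); lra.
apply/ler_addgt0Pl => e e0; have [N TN] := Tapprox _ _ la e0.
have := TN N (leqnn N); have := S_up a N; have := ar N.
by have := lerB_rnorm (T a) (S a N); lra.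
Qed.

(** Rosenthal's theorem. There are countably many pairs of distant small discs
    with centers in finite nets of the unit disc. If some pair oscillates along
    all infinite subsets of an infinite set, a subsequence spans a copy of l1.
    Otherwise a diagonal subsequence oscillates between no such pair, which
    means that it is weakly Cauchy. *)
Lemma rosenthal (x : nat -> X) : ucomplete X -> ~ contains_ell1 X ->
  (forall n, rnorm (x n) <= 1) ->
  exists2 M, unbounded M & forall (f : bop X C) (e : R), 0 < e ->
    exists N, forall m n, (N <= m)%N -> (N <= n)%N -> M m -> M n ->
      rnorm (f (x m) - f (x n)) <= e.
Proof.
move=> cX nl1 x1.
pose B := [set f : bop X C | forall z, rnorm (f z) <= rnorm z].
have netex k : exists s : seq C, forall z : C, rnorm z <= 1 ->
    exists2 y, y \in s & rnorm (z - y) <= k.+1%:R^-1.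
  have [|s _ net] := disc_tbounded (1 : R) (_ : 0 < k.+1%:R^-1 :> R).
    by rewrite invr_gt0.
  by exists s.
have [s net] := choice netex.
pose disc (i : nat * nat) (n : nat) : set (bop X C) :=
  [set f | rnorm (f (x n) - nth 0 (s i.1) i.2) <= i.1.+1%:R^-1].
pose far (kij : nat * (nat * nat)) :=
  8 * kij.1.+1%:R^-1 <= rnorm (nth 0 (s kij.1) kij.2.1 - nth 0 (s kij.1) kij.2.2).
pose Q (kij : nat * (nat * nat)) M := far kij -> forall f, B f ->
  ~ oscillates (disc (kij.1, kij.2.1)) (disc (kij.1, kij.2.2)) M f.
have [Qex|] := pselect (forall kij M, unbounded M ->
    exists2 M', M' `<=` M & unbounded M' /\ Q kij M'); last first.
  move=> /existsNP[kij /existsNP[M /not_implyP[uM /forall2NP noM]]]; exfalso.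
  case: kij noM => k [i j] noM.
  have nQ M' : M' `<=` M -> unbounded M' -> ~ Q (k, (i, j)) M'.
    by move=> M'M uM' QM'; case: (noM M') => [/(_ M'M)|[]].
  have farkij : far (k, (i, j)).
    by apply: contrapT => nf; apply: (nQ M) => // /nf.
  have oM : oscillating (disc (k, i)) (disc (k, j)) M B.
    move=> M' M'M uM'; apply: contrapT => nof; apply: (nQ M') => // _ f Bf of_.
    by apply: nof; exists f.
  have [e _ pattern] := independent_subsequence uM oM.
  apply: nl1; apply: (@lower_bound_ell1 (fun k => x (e k))
    (rnorm (nth 0 (s k) i - nth 0 (s k) j) / 8) cX) => //.
    by rewrite divr_gt0// (lt_le_trans _ farkij)// mulr_gt0// invr_gt0.
  apply: independent_lower_bound farkij _ => sigma n.
  have [f Bf fP] := pattern sigma n; exists f => // l /fP.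
  by rewrite /side; case: (sigma l).
have [|M _ [uM QM]] := diagonal_extraction _ Qex unboundedT.
  move=> kij M M' QM M'M fkij f Bf oM'; apply: (QM fkij f Bf).
  exact: oscillatesS oM'.
exists M => // f e e0.
pose c := rnorm f + 1; have c0 : 0 < c by rewrite ltr_wpDl// rnorm_ge0.
have ci0 : 0 <= c^-1 by rewrite invr_ge0 ltW.
(* normalization of f, which makes the values on the sequence lie in the unit
   disc *)
pose g : bop X C := c^-1%:C *: f.
have gE z : g z = c^-1%:C *: f z by [].
have Bg : B g.
  move=> z; rewrite gE (rnormZr _ ci0) ler_pdivrMl//.
  rewrite (le_trans (bop_rnormP _ _))// ler_wpM2r ?rnorm_ge0//.
  by rewrite /c lerDl.
have ec0 : 0 < e / c / 10 by rewrite !divr_gt0.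
have [k] := ltr_add_invr ec0; rewrite add0r => kec.
apply: contrapT => /forallNP noN.
pose rho : R := k.+1%:R^-1.
have labels N : exists ij : nat * nat, [/\ (ij.1 < size (s k))%N,
    (ij.2 < size (s k))%N, far (k, ij) &
    exists m n, [/\ (N <= m)%N, (N <= n)%N, M m, M n &
      disc (k, ij.1) m g /\ disc (k, ij.2) n g]].
  have [m [n [Nm Nn Mm Mn fmn]]] : exists m n, [/\ (N <= m)%N, (N <= n)%N,
      M m, M n & e < rnorm (f (x m) - f (x n))].
    apply: contrapT => nmn; apply: (noN N) => m n Nm Nn Mm Mn.
    by rewrite leNgt; apply/negP => mn; apply: nmn; exists m, n.
  have gx l : rnorm (g (x l)) <= 1 by rewrite (le_trans (Bg _)).
  have [y ys my] := net k _ (gx m); have [z zs nz] := net k _ (gx n).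
  exists (index y (s k), index z (s k)); rewrite !index_mem; split=> //.
    rewrite /far/= !nth_index//.
    have : e / c < rnorm (g (x m) - g (x n)).
      rewrite !gE -scalerBr (rnormZr _ ci0).
      by rewrite mulrC ltr_pM2l// invr_gt0.
    have := ler_rdistD y (g (x m)) (g (x n)); have := ler_rdistD z y (g (x n)).
    rewrite (rdistC z); move: my nz kec; rewrite -/rho; lra.
  by exists m, n; split=> //; rewrite /disc/= !nth_index.
have [ij ijP] := choice labels.
have [|[i j] _ uij] := @unbounded_pigeonhole _
    [seq (i, j) | i <- iota 0 (size (s k)), j <- iota 0 (size (s k))]
    setT (fun l N => ij N = l) unboundedT.
  move=> N _; exists (ij N) => //; have [i_s j_s _ _] := ijP N.
  by rewrite [ij N]surjective_pairing allpairs_f// mem_iota.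
have farij : far (k, (i, j)).
  by have [N _ [_ Nij]] := uij 0%N; have [_ _ + _] := ijP N; rewrite Nij.
apply: (QM (k, (i, j)) farij g Bg); split=> N0 /=.
  have [N NN [_ Nij]] := uij N0; have [_ _ _ [m [n [Nm Nn Mm Mn []]]]] := ijP N.
  by rewrite Nij => im _; exists m; [exact: leq_trans Nm|].
have [N NN [_ Nij]] := uij N0; have [_ _ _ [m [n [Nm Nn Mm Mn []]]]] := ijP N.
by rewrite Nij => _ jn; exists n; [exact: leq_trans Nn|].
Qed.

End rosenthal.

(** * Weakly null sequences and precompact families of operators *)

Lemma lipschitz_continuous {R : realType} (V : normedModType R[i]) (D : R)
    (q : V -> R) :
  (forall x y, q x - q y <= D * rnorm (x - y)) -> continuous q.
Proof.
move=> qD x; apply/cvgrPdist_le => e e0; pose c := `|D| + 1.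
have c0 : 0 < c by rewrite ltr_wpDl.
apply/nbhs_rnormP; exists (e / c); first by rewrite divr_gt0.
move=> y; rewrite ltr_pdivlMr// => xy.
have : D * rnorm (x - y) <= e.
  rewrite (le_trans _ (ltW xy))// mulrC ler_wpM2l ?rnorm_ge0//.
  by rewrite (le_trans (ler_norm D))// lerDl.
have := qD x y; have := qD y x; rewrite (rdistC y) ler_norml => *.
by apply/andP; split; lra.
Qed.

Section weakly_null_sequences.
Context {R : realType} {X : normedModType R[i]}.
Local Notation C := (R[i]^o).

Lemma norm_weakly_null (x_ : nat -> X) :
  (forall e : R, 0 < e -> exists N, forall n, (N <= n)%N -> rnorm (x_ n) <= e) ->
  weakly_null x_.
Proof.
move=> x0 f; apply/cvgn_rnormP => e e0; pose c := rnorm f + 1.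
have c0 : 0 < c by rewrite ltr_wpDl// rnorm_ge0.
have [|N xN] := x0 (e / c); first by rewrite divr_gt0.
exists N => n /xN; rewrite sub0r rnormN ler_pdivlMr// => xe.
rewrite (le_trans (bop_rnormP _ _))// (le_trans _ xe)// mulrC.
by rewrite ler_wpM2l ?rnorm_ge0// lerDl.
Qed.

(** The Banach-Steinhaus theorem on the dual, where the x_ n act by evaluation;
    norming functionals give back the norm of x_ n. *)
Lemma weakly_null_bounded (x_ : nat -> X) : weakly_null x_ ->
  exists2 D : R, 0 < D & forall n, rnorm (x_ n) <= D.
Proof.
move=> x0.
pose Q : set (bop X C -> R) := [set (fun f : bop X C => rnorm (f (x_ n))) | n in setT].
have [||D D0 QD] := @banach_steinhaus R (bop X C) Q (bop_ucomplete complex_ucomplete).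
- move=> _ [n _ <-]; split.
  + apply: (@lipschitz_continuous _ _ (rnorm (x_ n))) => f g.
    rewrite (le_trans (lerB_rnorm _ _))// mulrC.
    by rewrite -[X in rnorm X]/((f - g : bop X C) (x_ n)) bop_rnormP.
  + by move=> f g; exact: ler_rnormB.
  + by move=> a f; rewrite -[(a *: f) _]/(a *: f (x_ n)) rnormZ.
- move=> f; have /cvgn_rnormP/(_ 1 ltr01)[N fN] := x0 f.
  have [|r _ fr] := @eventually_bounded R (fun n => rnorm (f (x_ n))) N 1.
    by move=> n /fN; rewrite sub0r rnormN.
  by exists r => _ [n _ <-]; exact: fr.
exists D => // n.
have [|g [gx xg]] := @dominated_functional R X _ rnorm_seminorm 1 (x_ n).
  by move=> x; rewrite mul1r.
have g1 : rnorm g <= 1.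
  by apply: bop_rnorm_le => // x x1; rewrite (le_trans (gx x)).
have qn : Q (fun h : bop X C => rnorm (h (x_ n))) by exists n.
rewrite (le_trans xg)//; apply: le_trans (QD _ g qn) _.
by rewrite ler_piMr// ltW.
Qed.

Variables (p : X -> R) (pP : seminorm p).

(** On a bounded sequence, all but finitely many members of a null majorant are
    uniformly small. *)
Lemma precompact_ball_weakly_null (D : R) (x_ : nat -> X) :
  (forall x, p x <= D * rnorm x) ->
  tbounded (fun x y => p (x - y)) (@unit_ball R X) -> weakly_null x_ ->
  forall e, 0 < e -> exists N, forall n, (N <= n)%N -> p (x_ n) <= e.
Proof.
move=> pD tbB x0 e e0.
have [x' /cvgn_rnormP x'0 px'] := precompact_ball_majorant pP pD tbB.
have [B B0 xB] := weakly_null_bounded x0.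
have [|N x'N] := x'0 (e / B); first by rewrite divr_gt0.
have small k : exists m, forall n, (m <= n)%N -> rnorm (x' k (x_ n)) <= e.
  have /cvgn_rnormP/(_ e e0)[m xm] := x0 (x' k).
  by exists m => n /xm; rewrite sub0r rnormN.
have [m mP] := choice small.
exists (\max_(k < N) m k) => n mn; apply: px' => [|k]; first exact: ltW.
have [kN|/x'N x'k] := ltnP k N.
  by apply: mP; apply: leq_trans mn; exact: (leq_bigmax (Ordinal kN)).
rewrite (le_trans (bop_rnormP _ _))//.
move: x'k; rewrite sub0r rnormN ler_pdivlMr//; apply: le_trans.
by rewrite ler_wpM2l ?rnorm_ge0.
Qed.

(** A p-separated sequence in the ball has a weakly Cauchy subsequence, whose
    consecutive differences are weakly null. *)
Lemma weakly_null_precompact_ball : ucomplete X -> ~ contains_ell1 X ->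
  (forall x_ : nat -> X, weakly_null x_ ->
    forall e, 0 < e -> exists N, forall n, (N <= n)%N -> p (x_ n) <= e) ->
  tbounded (fun x y => p (x - y)) (@unit_ball R X).
Proof.
move=> cX nl1 p0; apply: separated_tbounded => e e0 x x1.
have [M uM Mc] := rosenthal cX nl1 (fun n => (unit_ballE (x n)).1 (x1 n)).
have [i [iM inc]] := unbounded_enum uM.
have [|N pN] := p0 (fun k => x (i k.+1) - x (i k)) _ e e0.
  move=> f; apply/cvgn_rnormP => d d0; have [N fN] := Mc f d d0.
  exists N => n Nn; rewrite sub0r rnormN linearB.
  by apply: fN => //; rewrite (leq_trans Nn)// ?incr_geq// ltnW// incr_geq.
exists (i N), (i N.+1); split; first exact: inc.
exact: pN.
Qed.

End weakly_null_sequences.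

Section operator_families.
Context {R : realType} {X E : normedModType R[i]}.
Local Notation C := (R[i]^o).
Implicit Types (K : set (bop X E)) (S : bop X E).

Definition bounded_family K :=
  exists2 D : R, 0 <= D & forall S x, K S -> rnorm (S x) <= D * rnorm x.

Definition family_image K : set E := [set S x | S in K & x in @unit_ball R X].

Definition family_seminorm K (x : X) : R :=
  fine (esup0 K (fun S => (rnorm (S x))%:E)).

Section family_seminorm_theory.
Variables (K : set (bop X E)) (Kb : bounded_family K).

Lemma family_seminormE x :
  esup0 K (fun S => (rnorm (S x))%:E) = (family_seminorm K x)%:E.
Proof.
have [D D0 KD] := Kb; rewrite fineK// ge0_fin_numE ?esup0_ge0//.
apply: (@le_lt_trans _ _ (D * rnorm x)%:E); last exact: ltry.
by apply: esup0_le => [|S KS]; rewrite lee_fin ?mulr_ge0 ?rnorm_ge0// KD.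
Qed.

Lemma family_seminorm_ub S x : K S -> rnorm (S x) <= family_seminorm K x.
Proof.
by move=> KS; rewrite -lee_fin -family_seminormE; apply: (esup0_ub _ KS).
Qed.

Lemma family_seminorm_le x M : 0 <= M ->
  (forall S, K S -> rnorm (S x) <= M) -> family_seminorm K x <= M.
Proof.
move=> M0 KM; rewrite -lee_fin -family_seminormE.
by apply: esup0_le => [|S KS]; rewrite lee_fin// KM.
Qed.

Lemma family_seminorm_ge0 x : 0 <= family_seminorm K x.
Proof. by rewrite -lee_fin -family_seminormE esup0_ge0. Qed.

Lemma family_seminormP : seminorm (family_seminorm K).
Proof.
have ub := family_seminorm_ub; have pos := family_seminorm_ge0.
split=> [x y|a x].
  apply: family_seminorm_le => [|S KS]; first by rewrite addr_ge0.
  by rewrite linearD (le_trans (ler_rnormD _ _))// lerD// ub.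
have scale_le (b : R[i]) z :
    family_seminorm K (b *: z) <= rnorm (b : C) * family_seminorm K z.
  apply: family_seminorm_le => [|S KS]; first by rewrite mulr_ge0// rnorm_ge0.
  by rewrite linearZ/= rnormZ ler_wpM2l ?rnorm_ge0// ub.
apply/eqP; rewrite eq_le scale_le/=.
have [->|a0] := eqVneq a 0; first by rewrite rnorm0 mul0r pos.
have ra0 : 0 < rnorm (a : C) by exact: rnorm_gt0.
rewrite -ler_pdivlMl//; have := scale_le a^-1 (a *: x).
rewrite scalerA mulVf// scale1r => /le_trans; apply.
rewrite ler_wpM2r// -(ler_pM2l ra0) -rnormM divff// rnorm1 divff//.
by rewrite gt_eqF.
Qed.

Lemma family_seminorm_bounded :
  exists D : R, forall x, family_seminorm K x <= D * rnorm x.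
Proof.
have [D D0 KD] := Kb; exists D => x.
apply: family_seminorm_le => [|S KS]; first by rewrite mulr_ge0// rnorm_ge0.
exact: KD.
Qed.

End family_seminorm_theory.

Lemma image_tbounded (T : eqType) (V : normedModType R[i]) (f : T -> V) (A : set T) :
  tbounded rdist (f @` A) -> tbounded (fun x y => rnorm (f x - f y)) A.
Proof.
move=> tbfA; apply: ultra_tbounded => F FU FA e e0.
have FfA : fmap f F (f @` A).
  by apply: (@filterS _ F _ _ _ _ FA) => x Ax; exists x.
have [B FB Be] := tbounded_ultra rdist_semidistance tbfA (ultra_fmap f FU) FfA e0.
by exists (f @^-1` B) => // x y Bx By; exact: Be.
Qed.

Lemma compact_family_bounded K : tbounded rdist K -> bounded_family K.
Proof.
move=> tbK; have [s sK net] := tbK 1 ltr01.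
have sum0 (t : seq (bop X E)) : 0 <= \sum_(S <- t) rnorm S.
  by rewrite sumr_ge0// => S _; exact: rnorm_ge0.
exists (1 + \sum_(S <- s) rnorm S); first by rewrite addr_ge0.
move=> S x /net[S' S's SS']; rewrite (le_trans (bop_rnormP _ _))//.
rewrite ler_wpM2r ?rnorm_ge0//.
have := lerB_rnorm S S'; have := sum0 (rem S' s).
have -> : \sum_(S <- s) rnorm S = rnorm S' + \sum_(S <- rem S' s) rnorm S.
  by rewrite (perm_big _ (perm_to_rem S's))/= big_cons.
by move: SS'; rewrite /rdist; lra.
Qed.

(** Each S B is totally bounded, and finitely many S suffice up to a small
    error. *)
Lemma compact_family_image K : tbounded rdist K ->
  (forall S, K S -> tbounded rdist (S @` @unit_ball R X)) ->
  tbounded rdist (family_image K).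
Proof.
move=> tbK tbS; apply: ultra_tbounded => F FU FA e e0.
have e40 : 0 < e / 4 by rewrite divr_gt0.
have [s sK net] := tbK _ e40.
have [|S Ss FS] := @ultra_seq _ _ s (fun S => [set y | exists2 x, unit_ball x &
    rnorm (y - S x) <= e / 4]) F FU.
  apply: (@filterS _ F _ _ _ _ FA) => _ [S KS [x x1 <-]].
  have [S' S's SS'] := net S KS; exists S' => //; exists x => //.
  rewrite -[X in rnorm X]/((S - S' : bop X E) x) (le_trans (bop_rnormP _ _))//.
  move/unit_ballE : x1 => x1; move: SS'; rewrite /rdist; apply: le_trans.
  by rewrite ler_piMr// rnorm_ge0.
have [t tS nett] := tbS S (sK S Ss) _ e40.
have [|z zt Fz] := @ultra_seq _ _ t (fun z => [set y | rnorm (y - z) <= e / 2]) F FU.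
  apply: (@filterS _ F _ _ _ _ FS) => y [x x1 yx].
  have [|z zt xz] := nett (S x); first by exists x.
  exists z => //; apply: le_trans (ler_rdistD (S x) _ _) _.
  by move: xz; rewrite /rdist; lra.
exists [set y | rnorm (y - z) <= e / 2] => // x y /= xz yz.
by apply: le_trans (ler_rdistD z _ _) _; rewrite (rdistC z); lra.
Qed.

Lemma compact_family_ball K : tbounded rdist K ->
  (forall S, K S -> tbounded rdist (S @` @unit_ball R X)) ->
  tbounded (fun x y => family_seminorm K (x - y)) (@unit_ball R X).
Proof.
move=> tbK tbS; have Kb := compact_family_bounded tbK.
apply: ultra_tbounded => F FU FA e e0.
have e40 : 0 < e / 4 by rewrite divr_gt0.
have [s sK net] := tbK _ e40.
have [i|i|B FB Be] := @tbounded_ultra_finite R 'I_(size s) X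
    (fun i x y => rnorm (nth 0 s i x - nth 0 s i y)) (@unit_ball R X) F _ _ FU FA _ e40.
- exact: (eval_semidistance (nth 0 s i)).
- by apply: (@image_tbounded _ _ (nth 0 s i)); apply: tbS; apply: sK; exact: mem_nth.
exists (B `&` @unit_ball R X); first exact: filterI.
move=> x y [Bx /unit_ballE x1] [By /unit_ballE y1].
apply: family_seminorm_le => // [|S KS]; first exact: ltW.
have [S' S's SS'] := net S KS.
have ix : (index S' s < size s)%N by rewrite index_mem.
have := Be (Ordinal ix) _ _ Bx By; rewrite /= nth_index// -linearB.
have := lerB_rnorm (S (x - y)) (S' (x - y)).
have := bop_rnormP (S - S' : bop X E) (x - y).
rewrite -[(S - S' : bop X E) (x - y)]/(S (x - y) - S' (x - y)).
have := ler_rnormB x y; move: SS'; rewrite /rdist.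
have := rnorm_ge0 (x - y); have := rnorm_ge0 (S - S' : bop X E); nra.
Qed.

(** Ascoli's argument: a member of K is determined up to a small error by its
    values at a finite net of the ball for the supremum seminorm, and these
    values lie in the totally bounded image. *)
Lemma precompact_familyP K : ucomplete E ->
  (precompact K /\ forall S, K S -> compact_operator S) <->
  [/\ bounded_family K, tbounded rdist (family_image K) &
    tbounded (fun x y => family_seminorm K (x - y)) (@unit_ball R X)].
Proof.
move=> cE; split=> [[/precompact_tbounded tbK cK]|[Kb tbI tbB]].
  have tbS S : K S -> tbounded rdist (S @` @unit_ball R X).
    by move=> /cK /precompact_tbounded.
  split; first exact: compact_family_bounded.
  - exact: compact_family_image.
  - exact: compact_family_ball.
have imS S : K S -> S @` @unit_ball R X `<=` family_image K.
  by move=> KS _ [x x1 <-]; exists S => //; exists x.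
split=> [|S KS]; last first.
  apply: tbounded_precompact => //.
  exact: (tboundedS rdist_semidistance (imS S KS) tbI).
apply: tbounded_precompact; first exact: bop_ucomplete.
apply: ultra_tbounded => F FU FK e e0.
have e30 : 0 < e / 3 by rewrite divr_gt0.
have [s sB net] := tbB _ e30.
have [i|i|B FB Be] := @tbounded_ultra_finite R 'I_(size s) (bop X E)
    (fun i S S' => rnorm (S (nth 0 s i) - S' (nth 0 s i))) K F _ _ FU FK _ e30.
- exact: (eval_semidistance (fun S : bop X E => S (nth 0 s i))).
- apply: (@image_tbounded _ _ (fun S : bop X E => S (nth 0 s i))).
  apply: (tboundedS rdist_semidistance _ tbI) => _ [S KS <-].
  by exists S => //; exists (nth 0 s i) => //; apply: sB; exact: mem_nth.
exists (B `&` K); first exact: filterI.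
move=> S S' [BS KS] [BS' KS']; apply: bop_rnorm_le => [|x x1]; first exact: ltW.
have /net[y ys xy] : unit_ball x by apply/unit_ballE.
have iy : (index y s < size s)%N by rewrite index_mem.
have := Be (Ordinal iy) _ _ BS BS'; rewrite /= nth_index// => Sy.
rewrite -[X in rnorm X]/(S x - S' x).
have -> : S x - S' x = (S y - S' y) + (S (x - y) - S' (x - y)).
  by rewrite (linearB S) (linearB S') opprB addrACA (addrC (S y)) subrK addKr.
have := ler_rnormD (S y - S' y) (S (x - y) - S' (x - y)).
have := ler_rnormB (S (x - y)) (S' (x - y)).
have := family_seminorm_ub Kb (x - y) KS; have := family_seminorm_ub Kb (x - y) KS'.
lra.
Qed.

Lemma null_majorantP K :
  (bounded_family K /\
    tbounded (fun x y => family_seminorm K (x - y)) (@unit_ball R X)) <->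
  exists2 x' : nat -> bop X C, x' @ \oo --> (0 : bop X C) &
    forall x : X, (esup0 K (fun S => (rnorm (S x))%:E) <=
      esup0 setT (fun n => (rnorm (x' n x))%:E))%E.
Proof.
split=> [[Kb tbB]|[x' x'0 Kx']].
  have [D pD] := family_seminorm_bounded Kb.
  have [x' x'0 px'] := precompact_ball_majorant (family_seminormP Kb) pD tbB.
  exists x' => // x; rewrite family_seminormE//.
  have := @esup0_ge0 R _ setT (fun n => (rnorm (x' n x))%:E).
  have := @esup0_ub R _ setT (fun n => (rnorm (x' n x))%:E).
  case: (esup0 _ _) => [r ub|ub _|ub]; [|by rewrite leey|by []].
  rewrite !lee_fin => r0.
  by apply: px' => // n; rewrite -lee_fin; exact: ub.
have bnd S x M : K S -> 0 <= M -> (forall n, rnorm (x' n x) <= M) -> rnorm (S x) <= M.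
  move=> KS M0 x'M; rewrite -lee_fin; apply: le_trans (_ : _ <= esup0 _ _)%E _.
    exact: (esup0_ub (fun S => (rnorm (S x))%:E) KS).
  by apply: le_trans (Kx' x) _; apply: esup0_le => // n _; rewrite lee_fin.
have [D D0 x'D] : exists2 D : R, 0 <= D & forall n, rnorm (x' n) <= D.
  move/cvgn_rnormP : x'0 => /(_ 1 ltr01)[N x'N].
  apply: (@eventually_bounded R (fun n => rnorm (x' n)) N 1) => n /x'N.
  by rewrite sub0r rnormN.
have Kb : bounded_family K.
  exists D => // S x KS; apply: bnd => // [|n]; first by rewrite mulr_ge0// rnorm_ge0.
  by rewrite (le_trans (bop_rnormP _ _))// ler_wpM2r ?rnorm_ge0.
have [|] := @majorant_precompact_ball R X (family_seminorm K) x' x'0; last by [].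
move=> x M M0 x'M.
by apply: family_seminorm_le => // S KS; exact: bnd.
Qed.

(** If K were unbounded, there would be vectors tending to 0 in norm, hence
    weakly, at which members of K take values of norm 1. *)
Lemma weakly_null_supP K : ucomplete X -> ~ contains_ell1 X ->
  (bounded_family K /\
    tbounded (fun x y => family_seminorm K (x - y)) (@unit_ball R X)) <->
  forall x_ : nat -> X, weakly_null x_ ->
    (fun n => esup0 K (fun S => (rnorm (S (x_ n)))%:E)) @ \oo --> (0%E : \bar R).
Proof.
move=> cX nl1; split=> [[Kb tbB] x_ x0|Kx0].
  have [D pD] := family_seminorm_bounded Kb.
  under eq_fun do rewrite family_seminormE//.
  apply: cvg_EFin; first exact: nearW.
  apply/cvgrPdist_le => e e0.
  have [N pN] := precompact_ball_weakly_null (family_seminormP Kb) pD tbB x0 e0.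
  exists N => // n /pN /=; rewrite sub0r normrN ger0_norm//.
  exact: family_seminorm_ge0.
have small x_ : weakly_null x_ -> forall e : R, 0 < e ->
    exists N, forall n, (N <= n)%N -> forall S, K S -> rnorm (S (x_ n)) <= e.
  move=> /Kx0 /fine_cvgP[fin /cvgrPdist_le pc] e /pc pe.
  have [N _ NP] : \forall n \near \oo, esup0 K (fun S => (rnorm (S (x_ n)))%:E) \is a fin_num /\
      `|0 - fine (esup0 K (fun S => (rnorm (S (x_ n)))%:E))| <= e.
    by apply: filterS2 fin pe => n.
  exists N => n /NP[finn]; rewrite sub0r normrN => ne S KS.
  rewrite -lee_fin; apply: le_trans (esup0_ub (fun S => (rnorm (S (x_ n)))%:E) KS) _.
  by rewrite -(fineK finn) lee_fin (le_trans (ler_norm _) ne).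
have Kb : bounded_family K.
  apply: contrapT => nKb.
  have big n : exists Sx : bop X E * X, K Sx.1 /\ n.+1%:R * rnorm Sx.2 < rnorm (Sx.1 Sx.2).
    apply: contrapT => nSx; apply: nKb; exists n.+1%:R => // S x KS.
    by rewrite leNgt; apply/negP => Sx; apply: nSx; exists (S, x).
  have [Sx SxP] := choice big.
  pose r n := rnorm ((Sx n).1 (Sx n).2).
  have r0 n : 0 < r n.
    by have [_] := SxP n; apply: le_lt_trans; rewrite mulr_ge0// rnorm_ge0.
  (* normalized so that (Sx n).1 takes y n to a vector of norm 1 *)
  pose y n := (r n)^-1%:C *: (Sx n).2.
  have ri0 n : 0 <= (r n)^-1 by rewrite invr_ge0 ltW.
  have y0 : weakly_null y.
    apply: norm_weakly_null => e e0.
    have [N] := ltr_add_invr e0; rewrite add0r => Ne; exists N => n Nn.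
    rewrite /y rnormZr// ler_pdivrMl//; have [_ big_n] := SxP n.
    apply: (@le_trans _ _ (n.+1%:R^-1 * r n)).
      by rewrite ler_pdivlMl// ltW.
    rewrite mulrC ler_wpM2l// ?(ltW (r0 n))// (le_trans _ (ltW Ne))//.
    by rewrite lef_pV2// ?posrE// ler_nat.
  have [|N yN] := small y y0 (1 / 2); first by [].
  have [KS _] := SxP N; have := yN N (leqnn N) _ KS.
  by rewrite /y linearZ/= rnormZr// mulVf ?gt_eqF//; lra.
split=> //; apply: weakly_null_precompact_ball => //.
move=> x_ x0 e e0; have [N NP] := small x_ x0 e e0; exists N => n Nn.
by apply: family_seminorm_le => // [|S KS]; [exact: ltW|exact: NP].
Qed.

End operator_families.

(** * Solid spaces of functions *)

Section solid_spaces.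
Context {R : realType} {S : ptopologicalType}.
Variables (mu : {measure set (borel S) -> \bar R}).
Variables (M : completeNormedModType R[i]) (ev : M -> S -> R[i]^o).
Hypothesis M_solid : solid_space mu ev.
Local Notation C := (R[i]^o).
Implicit Types (f g : S -> C) (A : set S) (m : M).

Let M_classes : space_of_classes mu ev := solid_classes M_solid.

Lemma ae_equal_refl f : ae_equal mu f f.
Proof. exact: aeW. Qed.

Lemma ae_equal_sym f g : ae_equal mu f g -> ae_equal mu g f.
Proof. by apply: filterS => s ->. Qed.

Lemma ae_equal_trans g f h :
  ae_equal mu f g -> ae_equal mu g h -> ae_equal mu f h.
Proof. by apply: filterS2 => s -> ->. Qed.

Lemma ev_class f : in_space mu ev f -> ae_equal mu (ev (class_of mu ev f)) f.
Proof. exact: (@xgetPex _ 0 [set m | ae_equal mu (ev m) f]). Qed.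

Lemma ev_eq m n : ae_equal mu (ev m) (ev n) -> m = n.
Proof.
move=> mn; apply/eqP; rewrite -subr_eq0; apply/eqP/(ev_inj M_classes).
rewrite addrC -scaleN1r; have := ev_linear M_classes (-1) n m.
by apply: filterS2 mn => s -> ->; rewrite mulN1r addNr.
Qed.

Lemma class_unique f m : ae_equal mu (ev m) f -> class_of mu ev f = m.
Proof.
move=> mf; apply: ev_eq; apply: ae_equal_trans (ae_equal_sym mf).
by apply: ev_class; exists m.
Qed.

Lemma class_ae f g : ae_equal mu f g -> in_space mu ev g ->
  class_of mu ev f = class_of mu ev g.
Proof.
move=> fg sg; apply: class_unique; apply: ae_equal_trans (ev_class sg) _.
exact: ae_equal_sym.
Qed.

Lemma in_space_ev m : in_space mu ev (ev m).
Proof. by exists m; exact: ae_equal_refl. Qed.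

Definition masked A f : S -> C := fun s => \1_A s * f s.

Lemma masked_in A f s : A s -> masked A f s = f s.
Proof. by move=> As; rewrite /masked indicE mem_set// mul1r. Qed.

Lemma masked_out A f s : ~ A s -> masked A f s = 0.
Proof. by move=> As; rewrite /masked indicE memNset// mul0r. Qed.

Lemma borel_fun_masked A f : measurable (A : set (borel S)) ->
  borel_fun f -> borel_fun (masked A f).
Proof.
move=> mA bf U oU.
have -> : masked A f @^-1` U =
    (A `&` f @^-1` U) `|` (~` A `&` [set s | U 0]).
  apply/seteqP; split=> s /=.
    have [As|nAs] := pselect (A s); first by rewrite masked_in//; left.
    by rewrite masked_out//; right.
  by move=> [[As]|[nAs]]; [rewrite masked_in|rewrite masked_out].
apply: measurableU; apply: measurableI => //; first exact: bf.
  exact: measurableC.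
have [U0|nU0] := pselect (U 0).
  have -> : [set _ : S | U 0] = setT by apply/seteqP; split.
  exact: measurableT.
have -> : [set _ : S | U 0] = set0 by apply/seteqP; split.
exact: measurable0.
Qed.

Lemma mu_measurable_masked A f : measurable (A : set (borel S)) ->
  mu_measurable mu f -> mu_measurable mu (masked A f).
Proof.
move=> mA [g bg fg]; exists (masked A g); first exact: borel_fun_masked.
by apply: filterS fg => s; rewrite /masked => ->.
Qed.

Lemma mu_measurable_continuous f : continuous f -> mu_measurable mu f.
Proof.
move=> cf; exists f; last exact: ae_equal_refl.
move=> U oU; apply: sub_sigma_algebra.
by apply: open_comp => // s _; exact: cf.
Qed.

Lemma measurable_closed A : closed A -> measurable (A : set (borel S)).
Proof.
move=> cA; rewrite -[A]setCK; apply: measurableC.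
by apply: sub_sigma_algebra; exact: closed_openC.
Qed.

Lemma masked_le A f s : `|masked A f s| <= `|f s|.
Proof.
have [As|nAs] := pselect (A s); first by rewrite masked_in.
by rewrite masked_out// normr0.
Qed.

Section cutoffs.
Variables (A : set S) (mA : measurable (A : set (borel S))).

Lemma masked_ev m : in_space mu ev (masked A (ev m)) /\
  `|class_of mu ev (masked A (ev m))| <= `|class_of mu ev (ev m)|.
Proof.
have mm := ev_measurable M_classes m.
apply: (solid_le M_solid) => //; last exact: in_space_ev.
  exact: mu_measurable_masked.
by apply: aeW => s; exact: masked_le.
Qed.

Lemma ev_cutoff m : ae_equal mu (ev (cutoff mu ev A m)) (masked A (ev m)).
Proof. by apply: ev_class; case: (masked_ev m). Qed.

Lemma cutoffB m n :
  cutoff mu ev A (m - n) = cutoff mu ev A m - cutoff mu ev A n.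
Proof.
have lin p q : ae_equal mu (ev (p - q)) (fun s => ev p s - ev q s).
  rewrite addrC -scaleN1r; have := ev_linear M_classes (-1) q p.
  by apply: filterS => s ->; rewrite mulN1r addrC.
apply: ev_eq; apply: ae_equal_trans (ev_cutoff _) _.
apply: ae_equal_sym; apply: ae_equal_trans (lin _ _) _.
have := ev_cutoff n; have := ev_cutoff m; have := lin m n.
by apply: filterS3 => s; rewrite /masked => -> -> ->; rewrite mulrBr.
Qed.

Lemma cutoff_le m : rnorm (cutoff mu ev A m) <= rnorm m.
Proof.
have [_] := masked_ev m; rewrite (class_unique (ae_equal_refl _)).
by rewrite !normE lecR.
Qed.

Lemma cutoff_class f : in_space mu ev f ->
  cutoff mu ev A (class_of mu ev f) = class_of mu ev (masked A f).
Proof.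
move=> sf; have fE := ev_class sf; rewrite /cutoff; apply: class_ae.
  by apply: filterS fE => s; rewrite /masked => ->.
have [[m mf] _] := masked_ev (class_of mu ev f); exists m.
by apply: filterS2 mf fE => s -> fs; rewrite /masked fs.
Qed.

End cutoffs.

Lemma cutoffC A m : measurable (A : set (borel S)) ->
  cutoff mu ev A m + cutoff mu ev (~` A) m = m.
Proof.
move=> mA; apply: ev_eq.
have mcA : measurable (~` A : set (borel S)) by exact: measurableC.
have lin : ae_equal mu (ev (cutoff mu ev A m + cutoff mu ev (~` A) m))
    (fun s => ev (cutoff mu ev A m) s + ev (cutoff mu ev (~` A) m) s).
  rewrite -[X in X + _]scale1r.
  have := ev_linear M_classes 1 (cutoff mu ev A m) (cutoff mu ev (~` A) m).
  by apply: filterS => s ->; rewrite mul1r.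
have := ev_cutoff mA m; have := ev_cutoff mcA m; have := lin.
apply: filterS3 => s -> -> ->.
have [As|nAs] := pselect (A s).
  by rewrite masked_in// masked_out ?addr0//; apply.
by rewrite masked_out// masked_in// add0r.
Qed.

(** Dominated convergence: the restrictions of a function to the complements of
    the L n are dominated by it and tend to 0 pointwise. *)
Lemma cutoff_tail (L : nat -> set S) m :
  (forall n, measurable (L n : set (borel S))) ->
  (forall s, exists N, forall n, (N <= n)%N -> L n s) ->
  forall e, 0 < e ->
    exists N, forall n, (N <= n)%N -> rnorm (cutoff mu ev (~` L n) m) <= e.
Proof.
move=> mL covL e e0.
have mcL n : measurable (~` L n : set (borel S)) by exact: measurableC.
have s0 : in_space mu ev (fun=> 0).
  exists 0; have := ev_linear M_classes (-1) 0 0.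
  by rewrite scaler0 addr0; apply: filterS => s ->; rewrite mulN1r addNr.
have c0 : class_of mu ev (fun=> 0) = 0 by apply: (ev_inj M_classes); exact: ev_class.
have [||n|n||N NP] := (cvgn_rnormP _ _).1
    (solid_dominated M_solid (f := fun=> 0) (g := ev m)
      (f_ := fun n => masked (~` L n) (ev m)) _ _ _ _ _) e e0.
- by [].
- exact: in_space_ev.
- by apply: mu_measurable_masked => //; exact: (ev_measurable M_classes).
- by apply: aeW => s; exact: masked_le.
- apply: aeW => s; apply/cvgn_rnormP => d d0; have [N NL] := covL s.
  exists N => n Nn; rewrite masked_out ?subr0 ?rnorm0 ?(ltW d0)// => nL.
  by apply: nL; exact: NL.
exists N => n /NP; rewrite c0 subr0 sub0r rnormN.
by rewrite /rnorm normr_id.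
Qed.

(** Dominated convergence, a multiple of the characteristic function of L being
    the majorant. *)
Lemma cutoff_bounded_cvg (L : set S) (f_ : nat -> S -> C) (f : S -> C) (r : R) :
  measurable (L : set (borel S)) -> (mu L < +oo)%E ->
  (forall n, mu_measurable mu (f_ n)) -> mu_measurable mu f ->
  (forall n s, L s -> rnorm (f_ n s) <= r) ->
  (forall s, L s -> (fun n => f_ n s) @ \oo --> f s) ->
  forall e, 0 < e -> exists N, forall n, (N <= n)%N ->
    rnorm (class_of mu ev (masked L (f_ n)) - class_of mu ev (masked L f)) <= e.
Proof.
move=> mL muL mf_ mf f_r f_f e e0.
have r0 (n : nat) s : L s -> 0 <= r.
  by move=> Ls; rewrite (le_trans _ (f_r n s Ls))// rnorm_ge0.
have fr s : L s -> rnorm (f s) <= r.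
  move=> Ls; apply/ler_addgt0Pl => d d0.
  have /cvgn_rnormP/(_ d d0)[N fN] := f_f s Ls.
  have := fN N (leqnn N); have := lerB_rnorm (f s) (f_ N s); have := f_r N s Ls.
  by lra.
pose g : S -> C := masked L (fun=> r%:C).
have ind := solid_indic M_solid mL muL.
have [k kE] := ind.
have gE : ae_equal mu (ev (r%:C *: k + 0)) g.
  rewrite addr0.
  have := ev_linear M_classes r%:C k (0 : M); rewrite addr0 => lin.
  have z0 : ae_equal mu (ev 0) (fun=> 0).
    have := ev_linear M_classes (-1) 0 0.
    by rewrite scaler0 addr0; apply: filterS => s ->; rewrite mulN1r addNr.
  move: z0 lin kE; apply: filterS3 => s z0 -> ->.
  by rewrite z0 addr0 /g /masked mulrC.
have sg : in_space mu ev g by exists (r%:C *: k + 0).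
have mr h : mu_measurable mu h -> mu_measurable mu (masked L h).
  exact: mu_measurable_masked.
have mg : mu_measurable mu g by apply: mr; apply: mu_measurable_continuous => s; exact: cvg_cst.
have dom h : (forall s, L s -> rnorm (h s) <= r) ->
    {ae mu, forall s : borel S, `|masked L h s| <= `|g s|}.
  move=> hr; apply: aeW => s; have [Ls|nLs] := pselect (L s).
    rewrite /g !masked_in// !normE lecR rnormC ger0_norm ?hr//.
    exact: (r0 0%N s).
  by rewrite /g !masked_out.
have sf : in_space mu ev (masked L f).
  by have [] := solid_le M_solid (mr _ mf) mg (dom _ fr) sg.
have [||n|n||N NP] := (cvgn_rnormP _ _).1
    (solid_dominated M_solid (f := masked L f) (g := g)
      (f_ := fun n => masked L (f_ n)) _ _ _ _ _) e e0.
- exact: sf.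
- exact: sg.
- exact: mr.
- by apply: dom => s; exact: f_r.
- apply: aeW => s; have [Ls|nLs] := pselect (L s).
    by rewrite masked_in//; under eq_fun do rewrite masked_in//; exact: f_f.
  rewrite masked_out//; under eq_fun do rewrite masked_out//.
  exact: cvg_cst.
by exists N => n /NP; rewrite sub0r rnormN /rnorm normr_id.
Qed.

End solid_spaces.

(** * Sequential compactness of bounded sets of antilinear functionals *)

Section antiduals.
Context {R : realType} {G : tvsType R[i]}.
Local Notation C := (R[i]^o).
Implicit Types (u v : antidual G) (x y : G).

Lemma antidualP u (a : R[i]) x y : u (a *: x + y) = (a^*)%R * u x + u y.
Proof. by case: u => u /= /antidual_predP[+ _]; apply. Qed.

Lemma antidual_continuous u : continuous u.
Proof. by case: u => u /= /antidual_predP[]. Qed.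

Lemma antidual0 u : u 0 = 0.
Proof.
have := antidualP u (-1) 0 0; rewrite scaler0 addr0 rmorphN1 mulN1r.
by rewrite addNr.
Qed.

Lemma antidualZ u (a : R[i]) x : u (a *: x) = (a^*)%R * u x.
Proof. by have := antidualP u a x 0; rewrite antidual0 !addr0. Qed.

Lemma antidualB u x y : u (x - y) = u x - u y.
Proof. by rewrite addrC -scaleN1r antidualP rmorphN1 mulN1r addrC. Qed.

Lemma antidual_rnorm_seminorm u : [/\ continuous (fun x => rnorm (u x)),
  forall x y, rnorm (u (x - y)) <= rnorm (u x) + rnorm (u y) &
  forall (a : R[i]) x, rnorm (u (a *: x)) = rnorm (a : C) * rnorm (u x)].
Proof.
split=> [x|x y|a x].
- apply: (@continuous_comp _ _ _ u (fun z : C => rnorm z)).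
    exact: antidual_continuous.
  apply: (@lipschitz_continuous _ _ 1) => y z.
  by rewrite mul1r lerB_rnorm.
- by rewrite antidualB ler_rnormB.
- by rewrite antidualZ (rnormM (_ : C)) rnorm_conj.
Qed.

Lemma antidual_eval_cvg (T : Type) (F : set_system T) {FF : Filter F}
    (f : T -> antidual G) u x :
  f @ F --> u -> (fun t => f t x) @ F --> u x.
Proof.
move=> fu; have ev_c : continuous (@antidual_eval R G) by exact: initial_continuous.
have fev : (fun t => antidual_eval (f t)) @ F --> antidual_eval u.
  by apply: (cvg_comp _ _ fu); exact: ev_c.
apply: (@cvg_comp _ _ _ (fun t => antidual_eval (f t)) (@proj G (fun=> C) x) F _ _ fev).
exact: (@proj_continuous G (fun=> C) x (antidual_eval u)).
Qed.

End antiduals.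

(** The Banach-Alaoglu theorem along an ultrafilter; continuity of the limit is
    where completeness of G enters, through Baire's theorem. *)
Lemma ultra_antidual {R : realType} {G : tvsType R[i]} (u : nat -> antidual G)
    (F : set_system nat) : countable_uniformity G -> ucomplete G ->
  (forall x, exists r : R, forall n, rnorm (u n x) <= r) -> UltraFilter F ->
  exists v : antidual G, forall x, (fun n => u n x) @ F --> v x.
Proof.
move=> cuG cG ubnd FU.
pose Q : set (G -> R) := [set (fun x => rnorm (u n x)) | n in setT].
have [||U U0 QU] := @uniform_boundedness R G Q cuG cG.
- by move=> _ [n _ <-]; exact: antidual_rnorm_seminorm.
- by move=> x; have [r ur] := ubnd x; exists r => _ [n _ <-].
have U1 n x : U x -> rnorm (u n x) <= 1.
  by move=> Ux; apply: (QU (fun x => rnorm (u n x)) x _ Ux); exists n.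
have lim x : exists z : R[i]^o, (fun n => u n x) @ F --> z.
  have [r ur] := ubnd x.
  apply: (@ultra_disc _ _ r (ultra_fmap (fun n => u n x) FU)).
  by apply: (@filterS _ F _ _ _ _ filterT) => n _ /=; exact: ur.
have [v vP] := choice lim.
have near_v x e : 0 < e -> F [set n | rnorm (v x - u n x) <= e].
  by move=> e0; exact: (@cvg_rnorm_near _ _ _ _ _ (vP x) _ e0).
have lv a x y : v (a *: x + y) = (a^*)%R * v x + v y.
  apply/eqP; rewrite -subr_eq0; apply/eqP/rnorm_small_eq0 => e e0.
  pose c := rnorm (a : R[i]^o) + 2.
  have c0 : 0 < c by rewrite ltr_wpDl// rnorm_ge0.
  have d0 : 0 < e / c by rewrite divr_gt0.
  have [n [[nx ny] nxy]] := @filter_ex _ F _ _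
    (filterI (filterI (near_v x _ d0) (near_v y _ d0)) (near_v (a *: x + y) _ d0)).
  have -> : v (a *: x + y) - ((a^*)%R * v x + v y) =
      (v (a *: x + y) - u n (a *: x + y)) -
      ((a^*)%R * (v x - u n x) + (v y - u n y)).
    by rewrite antidualP; ring.
  apply: le_trans (ler_rnormB _ _) _; apply: le_trans (lerD nxy (ler_rnormD _ _)) _.
  rewrite (rnormM (_ : R[i]^o)) rnorm_conj.
  apply: (@le_trans _ _ (c * (e / c))); last first.
    by rewrite mulrCA divff ?mulr1// gt_eqF.
  by have := ler_wpM2l (rnorm_ge0 (a : R[i]^o)) nx; move: ny => /=; rewrite /c; lra.
have v1 x : U x -> rnorm (v x) <= 1.
  move=> Ux; apply/ler_addgt0Pl => e e0.
  have [n /= vn] := @filter_ex _ F _ _ (near_v x _ e0).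
  by have := lerB_rnorm (v x) (u n x); have := U1 n x Ux; lra.
have v0 : v 0 = 0.
  have := lv (-1) 0 0; rewrite scaler0 addr0 rmorphN1 mulN1r.
  by rewrite addNr.
have vZ (a : R[i]) x : v (a *: x) = (a^*)%R * v x.
  by have := lv a x 0; rewrite v0 !addr0.
have vB x y : v (x - y) = v x - v y.
  by rewrite addrC -scaleN1r lv rmorphN1 mulN1r addrC.
have cv : continuous (v : G -> R[i]^o).
  move=> x; apply/continuous_rnorm => e e0.
  have ei : e^-1%:C *: (x - x) = 0 by rewrite subrr scaler0.
  have shift : (fun y : G => e^-1%:C *: (x - y)) @ x --> (0 : G).
    rewrite -[X in _ --> X]ei.
    apply: (@continuous_comp G (R[i]^o * G)%type G (fun y => (e^-1%:C, x - y))
      (fun z => z.1 *: z.2)); last exact: scale_continuous.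
    apply: (@cvg_pair _ _ _ _ (nbhs (e^-1%:C : R[i]^o))); first exact: cvg_cst.
    apply: (@continuous_comp G (G * G)%type G (fun y => (x, y))
      (fun z => z.1 - z.2)); last exact: sub_continuous.
    by apply: (@cvg_pair _ _ _ _ (nbhs x)); [exact: cvg_cst|exact: cvg_id].
  have Ux : nbhs x [set y | U (e^-1%:C *: (x - y))] := shift _ U0.
  apply: filterS Ux => y /= /v1.
  rewrite vZ vB (rnormM (_ : R[i]^o)) rnorm_conj rnormC.
  by rewrite ger0_norm ?invr_ge0 ?(ltW e0)// ler_pdivrMl// mulr1.
have pv : v \in @antidual_pred R G by apply/antidual_predP.
by exists (Antidual pv).
Qed.

(** The Banach-Steinhaus theorem on E, for the functionals e |-> inc e x with x
    in P. *)
Lemma weakly_bounded_eval {R : realType} {G : tvsType R[i]}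
    {E : normedModType R[i]} (inc : {linear E -> antidual G}) (P : set G) :
  ucomplete E -> continuous inc ->
  (forall u : antidual G, exists r : R, forall x, P x -> rnorm (u x) <= r) ->
  exists2 D : R, 0 < D & forall e x, P x -> rnorm (inc e x) <= D * rnorm e.
Proof.
move=> cE cinc Pbnd.
pose Q : set (E -> R) := [set (fun e => rnorm (inc e x)) | x in P].
have [||D D0 QD] := @banach_steinhaus R E Q cE.
- move=> _ [x Px <-]; split=> [e|e e'|a e].
  + apply: (@continuous_comp _ _ _ (fun e => inc e x) (fun z : R[i]^o => rnorm z)).
      by apply: (@antidual_eval_cvg _ _ _ (nbhs e)); exact: cinc.
    apply: (@lipschitz_continuous _ _ 1) => y z.
    by rewrite mul1r lerB_rnorm.
  + rewrite linearB -[(inc e - inc e') x]/(inc e x - inc e' x).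
    exact: ler_rnormB.
  + rewrite linearZ -[(a *: inc e) x]/(a *: inc e x).
    exact: rnormZ.
- by move=> e; have [r er] := Pbnd (inc e); exists r => _ [x Px <-]; exact: er.
exists D => // e x Px.
by apply: (QD (fun e => rnorm (inc e x))); exists x.
Qed.

Section compact_frame_pieces.
Context {R : realType} {S : ptopologicalType} {G : tvsType R[i]}.
Variables (w : S -> G).
Local Notation C := (R[i]^o).

Lemma continuous_compact_bounded (f : S -> C) (L : set S) :
  continuous f -> compact L -> exists r : R, forall s, L s -> rnorm (f s) <= r.
Proof.
move=> cf cL.
have cfL : compact ((fun s => rnorm (f s)) @` L).
  apply: continuous_compact => //; apply: continuous_subspaceT => s.
  apply: (@continuous_comp _ _ _ f (fun z : C => rnorm z)); first exact: cf.
  by apply: (@lipschitz_continuous _ _ 1) => y z; rewrite mul1r lerB_rnorm.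
have /pinfty_ex_gt0[r r0 fr] := compact_bounded cfL.
exists r => s Ls; apply: le_trans (ler_norm _) _.
by apply: fr; exists s.
Qed.

(** The h k map L to a separable space; the points d i form finite nets of L for
    the first n functions, for every n. By compactness, a limit t of points d i
    on which f vanishes can be found that the h k do not distinguish from s. *)
Lemma compact_countable_dense (h : nat -> S -> C) (L : set S) :
  (forall k, continuous (h k)) -> compact L ->
  exists d : (nat * nat) -> S, forall s, L s -> forall f : S -> C, continuous f ->
      (forall i, f (d i) = 0) ->
      exists2 t, L t & f t = 0 /\ forall k, h k t = h k s.
Proof.
move=> ch cL.
have netex n : exists s : seq S, (forall t, t \in s -> L t) /\ forall s', L s' ->
    exists2 t, t \in s & forall k, (k < n)%N -> rnorm (h k t - h k s') <= n.+1%:R^-1.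
  pose dn s t := \sum_(k < n) rnorm (h k s - h k t).
  have tbn : tbounded dn L.
    apply: ultra_tbounded => F FU FL e e0.
    have en0 : 0 < e / n.+1%:R by rewrite divr_gt0.
    have [k|k|B FB Be] := @tbounded_ultra_finite R 'I_n S
      (fun k s t => rnorm (h k s - h k t)) L F _ _ FU FL _ en0.
    - exact: eval_semidistance.
    - have [r hr] := continuous_compact_bounded (ch k) cL.
      exact: eval_tbounded hr.
    exists B => // s t Bs Bt.
    apply: (@le_trans _ _ (\sum_(k < n) e / n.+1%:R)).
      by apply: ler_sum => k _; exact: Be.
    rewrite sumr_const card_ord -[leLHS]mulr_natr -mulrA ler_piMr ?(ltW e0)//.
    by rewrite mulrC ler_pdivrMr// mul1r ler_nat.
  have [|s sL net] := tbn n.+1%:R^-1; first by rewrite invr_gt0.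
  exists s; split=> // s' /net[t ts tn]; exists t => // k kn.
  rewrite rdistC; apply: le_trans tn; rewrite /dn (bigD1 (Ordinal kn))//= lerDl.
  by rewrite sumr_ge0// => j _; exact: rnorm_ge0.
have [s sP] := choice netex.
have [[l0 Ll0]|L0] := pselect (L !=set0); last first.
  by exists (fun=> point) => t Lt; case: L0; exists t.
exists (fun nj => if (nj.2 < size (s nj.1))%N then nth l0 (s nj.1) nj.2 else l0).
move=> x Lx f cf fd.
have t_ex n : exists t, L t /\ f t = 0 /\
    forall k, (k < n)%N -> rnorm (h k t - h k x) <= n.+1%:R^-1.
  have [sL net] := sP n; have [t ts tn] := net x Lx.
  exists t; split; first exact: sL; split=> //.
  have := fd (n, index t (s n)); rewrite /= index_mem ts.
  by rewrite nth_index.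
have [t tP] := choice t_ex.
have [F [FU Foo]] := @ultraFilterLemma nat \oo _.
have := cL; rewrite compact_ultra => /(_ _ (ultra_fmap t FU)).
have FL : fmap t F L.
  by apply: Foo; exists 0%N => // n _ /=; case: (tP n).
move=> /(_ FL)[y [Ly ty]].
have uniq_lim (g : S -> C) z : continuous g ->
    (forall e : R, 0 < e -> exists N, forall n, (N <= n)%N -> rnorm (z - g (t n)) <= e) ->
    g y = z.
  move=> cg gz; have gy : (fun n => g (t n)) @ F --> g y.
    by apply: (@cvg_comp _ _ _ t g F _ _ ty); exact: cg.
  apply/eqP; rewrite -subr_eq0; apply/eqP/rnorm_small_eq0 => e e0.
  have e20 : 0 < e / 2 by rewrite divr_gt0.
  have F1 : F [set n | rnorm (g y - g (t n)) <= e / 2].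
    exact: (@cvg_rnorm_near _ _ _ _ _ gy _ e20).
  have F2 : F [set n | rnorm (z - g (t n)) <= e / 2].
    by apply: Foo; have [N gN] := gz _ e20; exists N => // n /= Nn; exact: gN.
  have [n [/= n1 n2]] := @filter_ex _ F _ _ (filterI F1 F2).
  apply: le_trans (ler_rdistD (g (t n)) _ _) _.
  by rewrite (rdistC (g (t n))); lra.
exists y => //; split.
  apply: uniq_lim => // e e0; exists 0%N => n _; have [_ [-> _]] := tP n.
  by rewrite subr0 rnorm0 ltW.
move=> k; apply: uniq_lim => [|e e0]; first exact: ch.
have [N] := ltr_add_invr e0; rewrite add0r => Ne; exists (maxn N k.+1) => n.
rewrite geq_max => /andP[Nn kn]; have [_ [_ /(_ k kn)]] := tP n.
rewrite rdistC => /le_trans; apply; rewrite (le_trans _ (ltW Ne))//.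
by rewrite lef_pV2// ?posrE// ler_nat.
Qed.

(** A diagonal subsequence converges at countably many points of L. Its limit
    points, which the Banach-Alaoglu theorem provides, are continuous in s, hence
    determined on L by their values at these points, so that they all agree. *)
Lemma antidual_subsequence (h : nat -> S -> C) (u : nat -> antidual G) (L : set S) :
  countable_uniformity G -> ucomplete G ->
  (forall v : antidual G, continuous (fun s => v (w s) : C)) ->
  (forall k, continuous (h k)) ->
  (forall s t, (forall k, h k s = h k t) -> w s = w t) ->
  compact L -> (forall x, exists r : R, forall n, rnorm (u n x) <= r) ->
  exists (e : nat -> nat) (v : antidual G), (forall k, (e k < e k.+1)%N) /\
    forall s, L s -> (fun k => u (e k) (w s)) @ \oo --> (v (w s) : C).
Proof.
move=> cuG cG cw ch hw cL ubnd.
have [d dP] := compact_countable_dense ch cL.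
have [|M uM Mc] := @diagonal_cauchy R _ (fun i n => u n (w (d i)) : C).
  by move=> i; exact: ubnd.
have [e [eM einc]] := unbounded_enum uM.
have uebnd x : exists r : R, forall k, rnorm (u (e k) x) <= r.
  by have [r ur] := ubnd x; exists r.
have [F [FU Foo]] := @ultraFilterLemma nat \oo _.
have [v vP] := ultra_antidual cuG cG uebnd FU.
exists e, v; split=> // s Ls; apply/cvgn_rnormP => r r0.
apply: contrapT => /forallNP far.
pose A := [set k | r < rnorm (v (w s) - u (e k) (w s))].
have GP : ProperFilter (within A \oo).
  apply: Build_ProperFilter_ex => B [N _ NB].
  apply: contrapT => nB; apply: (far N) => n Nn; rewrite leNgt; apply/negP => An.
  by apply: nB; exists n; apply: NB.
(* a second limit point, along the indices at which the first one is far away *)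
have [F' [FU' Foo']] := ultraFilterLemma GP.
have [v' vP'] := ultra_antidual cuG cG uebnd FU'.
have FA : F' A by apply: Foo'; exists 0%N.
have F'oo B : (\oo : set_system nat) B -> F' B.
  by move=> ooB; apply: Foo'; apply: filterS ooB => n Bn _.
have eqd i : v (w (d i)) - v' (w (d i)) = 0 :> C.
  apply: rnorm_small_eq0 => q q0.
  have q30 : 0 < q / 3 by rewrite divr_gt0.
  have [N NP] := Mc i _ q30.
  have ooN : (\oo : set_system nat) [set k | (N <= k)%N] by exists N.
  have F1 : F [set k | rnorm (v (w (d i)) - u (e k) (w (d i))) <= q / 3].
    exact: (@cvg_rnorm_near _ _ _ _ _ (vP (w (d i))) _ q30).
  have F2 : F' [set k | rnorm (v' (w (d i)) - u (e k) (w (d i))) <= q / 3].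
    exact: (@cvg_rnorm_near _ _ _ _ _ (vP' (w (d i))) _ q30).
  have [k [/= k1 kN]] := @filter_ex _ F _ _ (filterI F1 (Foo _ ooN)).
  have [l [/= l1 lN]] := @filter_ex _ F' _ _ (filterI F2 (F'oo _ ooN)).
  have := NP (e k) (e l) (leq_trans kN (incr_geq einc k))
    (leq_trans lN (incr_geq einc l)) (eM k) (eM l).
  have := ler_rdistD (u (e k) (w (d i)) : C) (v (w (d i))) (v' (w (d i))).
  have := ler_rdistD (u (e l) (w (d i)) : C) (u (e k) (w (d i))) (v' (w (d i))).
  rewrite (rdistC (u (e l) (w (d i)) : C) (v' _)); lra.
have cvv' : continuous (fun s => v (w s) - v' (w s) : C).
  move=> t; apply: (@continuousB _ _ _ (fun s => v (w s) : C) (fun s => v' (w s) : C)).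
    exact: cw.
  exact: cw.
have [t Lt [vt ht]] := dP s Ls _ cvv' eqd.
have /eqP := vt; rewrite (hw t s ht) subr_eq0 => /eqP vv'.
have F2 : F' [set k | rnorm (v' (w s) - u (e k) (w s)) <= r].
  exact: (@cvg_rnorm_near _ _ _ _ _ (vP' (w s)) _ r0).
have [k [/= Ak]] := @filter_ex _ F' _ _ (filterI FA F2).
by rewrite -vv' leNgt Ak.
Qed.

End compact_frame_pieces.

(** * Compactness in coorbit spaces *)

Lemma dense_closure (T : topologicalType) (D : set T) (x : T) :
  dense D -> closure D x.
Proof.
move=> dD B /nbhs_interior Bx; have [|y [By Dy]] := dD B° _ (@open_interior _ B).
  by exists x; exact: nbhs_singleton.
by exists y; split=> //; exact: interior_subset.
Qed.

(** Norming functionals of a dense sequence vanish jointly only at 0. *)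
Lemma separating_functionals {R : realType} (H : normedModType R[i]) :
  separable_space H ->
  exists f : nat -> bop H R[i]^o, forall v, (forall k, f k v = 0) -> v = 0.
Proof.
move=> [D cD dD].
have [d dE] : exists d : nat -> H, forall x, D x -> exists n, d n = x.
  move/pfcard_geP : cD => [->|/unsquash d]; first by exists (fun=> 0).
  by exists d => x /(@surj _ _ _ _ d)[n _ <-]; exists n.
have fex n : exists f : bop H R[i]^o, (forall x, rnorm (f x) <= rnorm x) /\
    rnorm (d n) <= rnorm (f (d n)).
  apply: (dominated_functional rnorm_seminorm (D := 1)) => z.
  by rewrite mul1r.
have [f fP] := choice fex.
exists f => v fv; apply: rnorm_small_eq0 => e e0.
have e20 : 0 < e / 2 by rewrite divr_gt0.
have /closure_rnormP/(_ _ e20)[x /dE[n <-] vd] : closure D v by exact: dense_closure.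
have [f1 fd] := fP n; have := f1 (v - d n); rewrite (linearB (f n))/= fv sub0r rnormN.
by have := lerB_rnorm v (d n); lra.
Qed.

Section coorbit_compactness.
Context {R : realType} {H : normedModType R[i]} {S : ptopologicalType}
  {G : tvsType R[i]}.
Variables (S_hausdorff : hausdorff_space S) (S_sigma : sigma_compact S).
Variables (mu : {measure set (borel S) -> \bar R}) (mu_radon : radon_measure mu).
Variables (H_separable : separable_space H) (G_frechet : frechet G).
Variables (iota : {linear G -> H}) (iota_inj : injective iota) (w : S -> G).
Hypothesis iota_w_continuous :
  forall f : bop H R[i]^o, continuous (fun s => f (iota (w s))).
Hypothesis w_continuous :
  forall u : antidual G, continuous (fun s => u (w s)).
Variables (M : completeNormedModType R[i]) (ev : M -> S -> R[i]^o).
Hypothesis M_solid : solid_space mu ev.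
Variables (E : completeNormedModType R[i]) (j : antidual G -> E).
Hypothesis E_completion :
  is_completion (coorbit mu w ev) (coorbit_norm mu w ev) j.
Variables (Phi : {linear E -> M}).
Hypothesis Phi_isometry : forall e : E, `|Phi e| = `|e|.
Hypothesis Phi_extends : forall u, coorbit mu w ev u ->
  Phi (j u) = class_of mu ev (phi w u).
Variables (inc : {linear E -> antidual G}).
Hypothesis inc_continuous : continuous inc.
Hypothesis inc_j : forall u, coorbit mu w ev u -> inc (j u) = u.

Lemma Phi_rnorm e : rnorm (Phi e) = rnorm e.
Proof. by rewrite /rnorm Phi_isometry. Qed.

Lemma compact_measurable (L : set S) :
  compact L -> measurable (L : set (borel S)).
Proof. by move=> cL; apply: measurable_closed; exact: compact_closed. Qed.

Lemma coorbit_dense (e : E) (d : R) : 0 < d ->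
  exists2 u, coorbit mu w ev u & rnorm (e - j u) <= d.
Proof.
have /closure_rnormP je : closure (j @` coorbit mu w ev) e.
  by apply: dense_closure; exact: completion_dense E_completion.
by move=> d0; have [_ [u uco <-] eu] := je d d0; exists u.
Qed.

(** Elements of co(M) approximating the members of a bounded set have, along a
    subsequence, voice transforms that converge pointwise and boundedly on L,
    hence in M after restriction to L; outside L they are small. *)
Lemma coorbit_tbounded (A : set E) (D : R) :
  (forall e, A e -> rnorm e <= D) ->
  (forall eps : R, 0 < eps -> exists2 L : set S, compact L &
    forall e, A e -> rnorm (cutoff mu ev (~` L) (Phi e)) <= eps) ->
  tbounded rdist A.
Proof.
move=> AD tails; apply: separated_tbounded => eps eps0 x Ax.
(* the errors are 2 d for the approximation by the coorbit space, 4 d on L and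
   4 d outside L *)
pose d := eps / 16; have d0 : 0 < d by rewrite divr_gt0.
have [u uP] := choice (fun n => (exists2P _ _).1 (coorbit_dense (x n) d0)).
have [L cL Ltail] := tails d d0.
have [Ghaus cuG cG] := G_frechet.
have cE := @complete_ucomplete E.
have ju n : rnorm (j (u n)) <= D + d.
  have [_ xu] := uP n; have := AD _ (Ax n).
  by have := lerB_rnorm (j (u n)) (x n); rewrite rdistC; lra.
have eval_bnd (P : set G) :
    (forall v : antidual G, exists r : R, forall y, P y -> rnorm (v y) <= r) ->
    exists r : R, forall n y, P y -> rnorm (u n y) <= r.
  move=> Pbnd; have [B B0 incB] := weakly_bounded_eval cE inc_continuous Pbnd.
  exists (B * (D + d)) => n y Py; have [uco _] := uP n.
  by rewrite -{1}(inc_j uco) (le_trans (incB _ _ Py))// ler_wpM2l// ltW.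
have ubnd y : exists r : R, forall n, rnorm (u n y) <= r.
  have [|r ur] := eval_bnd [set y]; first by move=> v; exists (rnorm (v y)) => _ ->.
  by exists r => n; exact: ur.
have [r ur] : exists r : R, forall n s, L s -> rnorm (u n (w s)) <= r.
  have [|r ur] := eval_bnd (w @` L).
    move=> v; have [r vr] := continuous_compact_bounded (@w_continuous v) cL.
    by exists r => _ [s Ls <-]; exact: vr.
  by exists r => n s Ls; apply: ur; exists s.
have [f fsep] := separating_functionals H_separable.
have sep s t : (forall k, f k (iota (w s)) = f k (iota (w t))) -> w s = w t.
  move=> fst; apply/iota_inj/eqP; rewrite -subr_eq0; apply/eqP/fsep => k.
  by rewrite (linearB (f k))/= fst subrr.
have [i [v [iinc uv]]] := antidual_subsequence cuG cG w_continuous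
  (fun k => @iota_w_continuous (f k)) sep cL ubnd.
have mL := compact_measurable cL.
have mcL : measurable (~` L : set (borel S)) by exact: measurableC.
have d20 : 0 < 2 * d by rewrite mulr_gt0.
have [|n|||N NP] := cutoff_bounded_cvg M_solid
    (f_ := fun k => phi w (u (i k))) (f := phi w v) (r := r) mL _ _ _ _ uv d20.
- exact: (radon_compact mu_radon).
- by apply: mu_measurable_continuous; exact: w_continuous.
- by apply: mu_measurable_continuous; exact: w_continuous.
- by move=> n s; exact: ur.
exists (i N), (i N.+1); split; first exact: iinc.
pose P n := Phi (j (u n)).
have PE n : P n = class_of mu ev (phi w (u n)) by apply: Phi_extends; case: (uP n).
have coP n : in_space mu ev (phi w (u n)) by case: (uP n).
have P_out n : rnorm (cutoff mu ev (~` L) (P n)) <= 2 * d.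
  have [_ xu] := uP n; have := Ltail _ (Ax n).
  have := lerB_rnorm (cutoff mu ev (~` L) (P n)) (cutoff mu ev (~` L) (Phi (x n))).
  rewrite -(cutoffB M_solid mcL) => h1 h2.
  have := cutoff_le M_solid mcL (P n - Phi (x n)).
  have : rnorm (P n - Phi (x n)) <= d by rewrite /P -linearB Phi_rnorm rdistC.
  by lra.
have P_in : rnorm (cutoff mu ev L (P (i N) - P (i N.+1))) <= 4 * d.
  rewrite (cutoffB M_solid mL) !PE !(cutoff_class M_solid mL)//.
  apply: le_trans (ler_rdistD (class_of mu ev (masked L (phi w v))) _ _) _.
  have := NP N (leqnn N); have := NP N.+1 (leqnSn N).
  by rewrite (rdistC (class_of mu ev (masked L (phi w v)))); lra.
have := ler_rnormD (cutoff mu ev L (P (i N) - P (i N.+1)))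
  (cutoff mu ev (~` L) (P (i N) - P (i N.+1))).
rewrite (cutoffC M_solid _ mL) [in X in _ <= _ + X](cutoffB M_solid mcL).
have -> : rnorm (P (i N) - P (i N.+1)) = rnorm (j (u (i N)) - j (u (i N.+1))).
  by rewrite /P -linearB Phi_rnorm.
have [_ x1] := uP (i N); have [_ x2] := uP (i N.+1).
have := ler_rnormB (cutoff mu ev (~` L) (P (i N))) (cutoff mu ev (~` L) (P (i N.+1))).
have := P_out (i N); have := P_out (i N.+1); move: P_in.
have := ler_rdistD (j (u (i N.+1))) (x (i N.+1)) (x (i N)).
have := ler_rdistD (j (u (i N))) (j (u (i N.+1))) (x (i N)).
rewrite /rdist (rdistC (j (u (i N))) (x _)) (rdistC (j (u (i N.+1))) (j _)).
have dE : eps = 16 * d by rewrite /d; lra.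
by rewrite dE; lra.
Qed.

Lemma tbounded_coorbit_tails (A : set E) : tbounded rdist A ->
  forall eps : R, 0 < eps -> exists2 L : set S, compact L &
    forall e, A e -> rnorm (cutoff mu ev (~` L) (Phi e)) <= eps.
Proof.
move=> tbA eps eps0; have e20 : 0 < eps / 2 by rewrite divr_gt0.
have [s sA net] := tbA _ e20; have [K cK covK] := S_sigma.
pose L n := \big[setU/set0]_(k < n) K k.
have cL n : compact (L n) by apply: bigsetU_compact => k _; exact: cK.
have mL n := compact_measurable (cL n).
have covL t : exists N, forall n, (N <= n)%N -> L n t.
  have [k _ Kt] : (\bigcup_n K n) t by rewrite covK.
  exists k.+1 => n kn; rewrite /L -bigcup_mkord; exists k => //=.
have tail e : exists N, forall n, (N <= n)%N ->
    rnorm (cutoff mu ev (~` L n) (Phi e)) <= eps / 2.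
  exact: (cutoff_tail M_solid (Phi e) mL covL e20).
have [N NP] := choice tail.
exists (L (\max_(e <- s) N e)); first exact: cL.
move=> e /net[y ys ey]; set n := \max_(e <- s) N e.
have mcL : measurable (~` L n : set (borel S)) by apply: measurableC; exact: mL.
have yn : (N y <= n)%N by exact: leq_bigmax_seq.
have := NP y n yn.
have := lerB_rnorm (cutoff mu ev (~` L n) (Phi e)) (cutoff mu ev (~` L n) (Phi y)).
rewrite -(cutoffB M_solid mcL) -(linearB Phi).
have := cutoff_le M_solid mcL (Phi (e - y)); rewrite Phi_rnorm.
by move: ey; rewrite /rdist; lra.
Qed.

End coorbit_compactness.

Local Close Scope complex_scope.

Theorem corollary5p2 (R : realType)
  (H : completeNormedModType R[i]) (ip : {dot H for Num.conj})
  (H_ip : forall u : H, ip u u = `|u| ^+ 2)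
  (H_separable : separable_space H)
  (Sigma : ptopologicalType)
  (Sigma_hausdorff : hausdorff_space Sigma)
  (Sigma_locally_compact : locally_compact [set: Sigma])
  (Sigma_sigma_compact : sigma_compact Sigma)
  (mu : {measure set (borel Sigma) -> \bar R})
  (mu_radon : radon_measure mu)
  (G : tvsType R[i]) (G_frechet : frechet G)
  (iota : {linear G -> H})
  (iota_inj : injective iota)
  (iota_continuous : continuous iota)
  (iota_dense : dense (range iota))
  (w : Sigma -> G)
  (w_frame : tight_frame mu ip (iota \o w))
  (w_total : total_set (range w))
  (w_continuous : forall u : antidual G, continuous (fun s => u (w s)))
  (* the solid space M; ev picks a representative of each class *)
  (M : completeNormedModType R[i]) (ev : M -> Sigma -> R[i]^o)
  (M_solid : solid_space mu ev)
  (* the completed coorbit space E, and phi_W : E -> M *)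
  (E : completeNormedModType R[i]) (j : antidual G -> E)
  (E_completion : is_completion (coorbit mu w ev) (coorbit_norm mu w ev) j)
  (Phi : {linear E -> M})
  (Phi_isometry : forall e : E, `|Phi e| = `|e|)
  (Phi_extends : forall u, coorbit mu w ev u ->
     Phi (j u) = class_of mu ev (phi w u))
  (E_embedded : exists inc : {linear E -> antidual G},
     [/\ continuous inc, injective inc &
         forall u, coorbit mu w ev u -> inc (j u) = u])
  (X : completeNormedModType R[i])
  (K : set (bop X E)) :
  let compact_family :=
    precompact K /\ (forall S, K S -> compact_operator S) in
  let condition1 :=
    forall eps : R, 0 < eps -> exists2 L : set Sigma, compact L &
      (esup0 K (fun S => opnorm (fun x => cutoff mu ev (~` L) (Phi (S x))))
        <= eps%:E)%E in
  let condition2 :=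
    exists2 x' : nat -> bop X R[i]^o, x' @ \oo --> (0 : bop X R[i]^o) &
      forall x : X,
        (esup0 K (fun S => (rnorm (Phi (S x)))%:E)
          <= esup0 setT (fun n => (rnorm (x' n x))%:E))%E in
  let condition2' :=
    forall x_ : nat -> X, weakly_null x_ ->
      (fun n => esup0 K (fun S => (rnorm (Phi (S (x_ n))))%:E)) @ \oo
        --> (0%E : \bar R) in
  (compact_family <-> condition1 /\ condition2) /\
  (~ contains_ell1 X -> (compact_family <-> condition1 /\ condition2')).
Proof.
move=> compact_family condition1 condition2 condition2'.
have [inc [inc_c _ inc_j]] := E_embedded.
have cE := @complete_ucomplete E; have cX := @complete_ucomplete X.
have PhiE e : rnorm (Phi e) = rnorm e by rewrite /rnorm Phi_isometry.
have iota_w (f : bop H R[i]^o) : continuous (fun s => f (iota (w s))).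
  by have [fw _] := w_frame; exact: fw.
have cond1E : condition1 <-> forall eps : R, 0 < eps ->
    exists2 L : set Sigma, compact L & forall e, family_image K e ->
      rnorm (cutoff mu ev (~` L) (Phi e)) <= eps.
  split=> c1 eps eps0; have [L cL LK] := c1 eps eps0; exists L => //.
    move=> _ [S KS [x x1 <-]]; rewrite -lee_fin; apply: le_trans LK.
    apply: le_trans (esup0_ub _ KS).
    exact: (esup0_ub (fun x => (rnorm (cutoff mu ev (~` L) (Phi (S x))))%:E) x1).
  apply: esup0_le => [|S KS]; first by rewrite lee_fin ltW.
  apply: esup0_le => [|x x1]; first by rewrite lee_fin ltW.
  by rewrite lee_fin; apply: LK; exists S => //; exists x.
have cond1P : bounded_family K -> condition1 <-> tbounded rdist (family_image K).
  move=> [D D0 KD]; rewrite cond1E; split=> [c1|tbK].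
    apply: (coorbit_tbounded Sigma_hausdorff mu_radon H_separable G_frechet
      iota_inj iota_w w_continuous M_solid E_completion Phi_isometry Phi_extends
      inc_c inc_j (D := D)) => // _ [S KS [x /unit_ballE x1 <-]].
    by rewrite (le_trans (KD S x KS))// ler_piMr.
  exact: tbounded_coorbit_tails.
have supE (x : X) : esup0 K (fun S => (rnorm (Phi (S x)))%:E) =
    esup0 K (fun S => (rnorm (S x))%:E).
  by congr (esup0 K _); apply/funext => S; rewrite PhiE.
have cond2E : condition2 <-> (bounded_family K /\
    tbounded (fun x y => family_seminorm K (x - y)) (@unit_ball R X)).
  rewrite null_majorantP; split=> -[x' x'0 Kx']; exists x' => // x.
    by rewrite -supE.
  by rewrite supE.
have familyE : compact_family <-> condition1 /\ (bounded_family K /\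
    tbounded (fun x y => family_seminorm K (x - y)) (@unit_ball R X)).
  rewrite /compact_family precompact_familyP//; split=> [[Kb tbI tbB]|[c1 [Kb tbB]]].
    by split=> //; apply/cond1P.
  by split=> //; apply/cond1P.
split; first by rewrite familyE cond2E.
move=> nl1; rewrite familyE (weakly_null_supP K cX nl1).
split=> -[c1 c2]; split=> // x_ /c2.
  by under eq_fun do rewrite -supE.
by under eq_fun do rewrite supE.
Qed.
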